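(* Let $p\in[1,\infty]$ and $q\in[1,\infty)$ with $q\le p$, let $\mu_i,\tilde\mu_i\in\mathcal P_p(X_i)$ for $i=1,\dots,N$, let $c:X\to[0,\infty)$ be continuous with growth of order $p$ and satisfy $(\mathrm A_L)$, and suppose $\mu_1,\dots,\mu_N$ satisfy $(\mathrm I_q)$ with constant $C_q$. Let $\pi^*,\tilde\pi^*$ be the optimizers of $S_{\rm ent}(\mu_1,\dots,\mu_N,c)$ and $S_{\rm ent}(\tilde\mu_1,\dots,\tilde\mu_N,c)$, and $\Delta:=W_p(\mu_1,\dots,\mu_N;\tilde\mu_1,\dots,\tilde\mu_N)$. Then $$W_q(\pi^*,\tilde\pi^* )\le N^{\frac1q-\frac1p}\Delta+C_q(2L\Delta)^{\frac1{2q}}.$$ If instead $\mu_1,\dots,\mu_N$ satisfy $(\mathrm I'_q)$ with constant $C'_q$, then $$W_q(\pi^*,\tilde\pi^* )\le N^{\frac1q-\frac1p}\Delta+C'_q\big[(2L\Delta)^{\frac1q}+(L\Delta)^{\frac1{2q}}\big].$$ In particular, $(\mu_1,\dots,\mu_N)\mapsto\pi^*$ is $\frac1{2p}$-Hölder continuous in $W_p$ on any $W_p$-bounded set of marginal tuples satisfying $(\mathrm A_L)$ and $(\mathrm I_p)$ (or $(\mathrm I'_p)$) with given constants.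
   Context: $(X_i,d_{X_i})$ Polish, $X=\prod_{i=1}^NX_i$; $d_{X,r}(x,y)=(\sum_id_{X_i}(x_i,y_i)^r)^{1/r}$ ($r<\infty$), $\max_id_{X_i}(x_i,y_i)$ ($r=\infty$); $W_r$ on $X$ is w.r.t. $d_{X,r}$. $\mathcal P_p$: finite $p$-th moment (bounded support for $p=\infty$). $W_p(\mu_1,\dots,\mu_N;\tilde\mu_1,\dots,\tilde\mu_N)=(\sum_iW_p(\mu_i,\tilde\mu_i)^p)^{1/p}$ ($\max_i$ for $p=\infty$). Growth of order $p$: $|c(x)|\le C(1+d_{X,p}(x,\hat x)^p)$ ($c$ bounded if $p=\infty$). $S_{\rm ent}(\mu_1,\dots,\mu_N,c)=\inf_{\pi\in\Pi(\mu_1,\dots,\mu_N)}\int c\,d\pi+D_{\rm KL}(\pi,\mu_1\otimes\cdots\otimes\mu_N)$, with unique optimizer; $\Pi$ = couplings. $(\mathrm A_L)$: $|\int c\,d(\pi-\tilde\pi)|\le L\,W_p(\pi,\tilde\pi)$ for all $\pi\in\Pi(\mu_1,\dots,\mu_N),\tilde\pi\in\Pi(\tilde\mu_1,\dots,\tilde\mu_N)$. $(\mathrm I_q)$: $W_q(\pi,\theta)\le C_qD_{\rm KL}(\theta,\pi)^{1/(2q)}$ for all $\pi,\theta\in\Pi(\mu_1,\dots,\mu_N)$. $(\mathrm I'_q)$: $W_q(\pi,\theta)\le C'_q[D_{\rm KL}(\theta,\pi)^{1/q}+(D_{\rm KL}(\theta,\pi)/2)^{1/(2q)}]$ for all $\pi,\theta\in\Pi(\mu_1,\dots,\mu_N)$.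 *)

(* Defs.v *)
From HB Require Import structures.
From mathcomp Require Import all_boot all_order all_algebra.
From mathcomp Require Import all_classical all_reals all_analysis ess_sup_inf.
Unset Printing Implicit Defensive.
Import Order.TTheory GRing.Theory Num.Theory.
Import numFieldNormedType.Exports.
Local Open Scope classical_set_scope.
Local Open Scope ring_scope.

Definition is_metric {T : Type} {R : realType} (dist : T -> T -> R) : Prop :=
  [/\ (forall x y, 0 <= dist x y),
      (forall x y, dist x y = 0 <-> x = y),
      (forall x y, dist x y = dist y x) &
      (forall x y z, dist x z <= dist x y + dist y z)].

Definition metric_complete {T : Type} {R : realType} (dist : T -> T -> R) : Prop :=
  forall u : nat -> T,
    (forall e : R, 0 < e -> exists n0, forall m n, (n0 <= m)%N -> (n0 <= n)%N ->
        dist (u m) (u n) < e) ->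
    exists l, forall e : R, 0 < e -> exists n0, forall n, (n0 <= n)%N -> dist (u n) l < e.

Definition metric_separable {T : Type} {R : realType} (dist : T -> T -> R) : Prop :=
  exists D : set T, countable D /\
    forall x (e : R), 0 < e -> exists y, D y /\ dist x y < e.

Definition metric_open {T : Type} {R : realType} (dist : T -> T -> R) (A : set T) : Prop :=
  forall x, A x -> exists r : R, 0 < r /\ forall y, dist x y < r -> A y.

Definition polish_borel {d} {T : measurableType d} {R : realType}
    (dist : T -> T -> R) : Prop :=
  [/\ is_metric dist, metric_complete dist, metric_separable dist &
      (measurable : set (set T)) = <<s metric_open dist >>].

(* The product space X = prod_i X_i with the product sigma-algebra      *)
(* (= Borel sigma-algebra of the product topology, X_i being separable) *)

Definition cylinders {N : nat} {dX : 'I_N -> measure_display}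
    (X : forall i, measurableType (dX i)) : set (set (forall i, X i)) :=
  [set B | exists i (A : set (X i)), measurable A /\ B = [set x | A (x i)]].

Definition ProdX {N : nat} {dX : 'I_N -> measure_display}
    (X : forall i, measurableType (dX i)) := g_sigma_algebraType (cylinders X).

Definition einv {R : realType} (r : \bar R) : R :=
  match r with r'%:E => r'^-1 | _ => 0 end.

Definition dXr {R : realType} {N : nat} {dX : 'I_N -> measure_display}
    {X : forall i, measurableType (dX i)} (dist : forall i, X i -> X i -> R)
    (r : \bar R) (x y : ProdX X) : R :=
  match r with
  | r'%:E => (\sum_(i < N) (dist i (x i) (y i)) `^ r') `^ r'^-1
  | _ => \big[Num.max/0]_(i < N) dist i (x i) (y i)
  end.

Definition coupling2 {d} {T : measurableType d} {R : realType}
    (mu nu : probability T R) (g : probability (T * T)%type R) : Prop :=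
  forall A : set T, measurable A ->
    g (A `*` setT) = mu A /\ g (setT `*` A) = nu A.

Definition wcost {d} {T : measurableType d} {R : realType}
    (dist : T -> T -> R) (r : \bar R) (g : probability (T * T)%type R) : \bar R :=
  match r with
  | r'%:E => ((\int[g]_z ((dist z.1 z.2) `^ r')%:E) `^ r'^-1)%E
  | _ => ess_sup g (fun z => (dist z.1 z.2)%:E)
  end.

Definition Wass {d} {T : measurableType d} {R : realType}
    (dist : T -> T -> R) (r : \bar R) (mu nu : probability T R) : \bar R :=
  ereal_inf [set e | exists g, coupling2 mu nu g /\ e = wcost dist r g].

Definition Pp {d} {T : measurableType d} {R : realType}
    (dist : T -> T -> R) (p : \bar R) (mu : probability T R) : Prop :=
  match p with
  | p'%:E => exists x0 : T, (\int[mu]_x ((dist x0 x) `^ p')%:E < +oo)%E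
  | _ => exists (x0 : T) (M : R), mu [set x | M < dist x0 x] = 0%E
  end.

Definition is_coupling {R : realType} {N : nat} {dX : 'I_N -> measure_display}
    {X : forall i, measurableType (dX i)} (mu : forall i, probability (X i) R)
    (pi : probability (ProdX X) R) : Prop :=
  forall i (A : set (X i)), measurable A -> pi [set x | A (x i)] = mu i A.

(* P is the product measure mu_1 (x) ... (x) mu_N (uniquely determined by
   its values on measurable boxes) *)
Definition is_product_measure {R : realType} {N : nat} {dX : 'I_N -> measure_display}
    {X : forall i, measurableType (dX i)} (mu : forall i, probability (X i) R)
    (P : probability (ProdX X) R) : Prop :=
  forall A : forall i, set (X i), (forall i, measurable (A i)) ->
    P [set x | forall i, A i (x i)] = (\prod_(i < N) mu i (A i))%E.

(* D_KL(th, pi) = int (dth/dpi) ln (dth/dpi) dpi if th << pi, +oo otherwise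
   (infimum over the empty set of densities is +oo; all densities agree
   pi-a.e. so the infimum is the common value otherwise) *)
Definition KL {d} {T : measurableType d} {R : realType}
    (th pi : probability T R) : \bar R :=
  ereal_inf [set e | exists f : T -> R,
    [/\ measurable_fun setT f, (forall x, 0 <= f x),
        (forall A, measurable A -> (th A = \int[pi]_(x in A) (f x)%:E)%E) &
        e = (\int[pi]_x (f x * ln (f x))%:E)%E]].

(* value of S_ent(mu_1, ..., mu_N, c), P being the product of the mu_i *)
Definition Sent {R : realType} {N : nat} {dX : 'I_N -> measure_display}
    {X : forall i, measurableType (dX i)} (mu : forall i, probability (X i) R)
    (P : probability (ProdX X) R) (c : ProdX X -> R) : \bar R :=
  ereal_inf [set e | exists pi, is_coupling mu pi /\
     e = (\int[pi]_x (c x)%:E + KL pi P)%E].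

Definition is_Sent_optimizer {R : realType} {N : nat} {dX : 'I_N -> measure_display}
    {X : forall i, measurableType (dX i)} (mu : forall i, probability (X i) R)
    (P : probability (ProdX X) R) (c : ProdX X -> R) (pi : probability (ProdX X) R)
    : Prop :=
  is_coupling mu pi /\ (\int[pi]_x (c x)%:E + KL pi P)%E = Sent mu P c.

(* continuity w.r.t. the product topology (metrized by d_{X,oo}) *)
Definition cost_continuous {R : realType} {N : nat} {dX : 'I_N -> measure_display}
    {X : forall i, measurableType (dX i)} (dist : forall i, X i -> X i -> R)
    (c : ProdX X -> R) : Prop :=
  forall x (e : R), 0 < e -> exists del : R, 0 < del /\
    forall y, dXr dist +oo%E x y < del -> `|c x - c y| < e.

Definition growth_order {R : realType} {N : nat} {dX : 'I_N -> measure_display}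
    {X : forall i, measurableType (dX i)} (dist : forall i, X i -> X i -> R)
    (p : \bar R) (c : ProdX X -> R) : Prop :=
  match p with
  | p'%:E => exists (C : R) (xh : ProdX X), forall x,
      `|c x| <= C * (1 + (dXr dist p x xh) `^ p')
  | _ => exists C : R, forall x, `|c x| <= C
  end.

Definition WX {R : realType} {N : nat} {dX : 'I_N -> measure_display}
    {X : forall i, measurableType (dX i)} (dist : forall i, X i -> X i -> R)
    (r : \bar R) (pi th : probability (ProdX X) R) : \bar R :=
  Wass (dXr dist r) r pi th.

Definition cond_A {R : realType} {N : nat} {dX : 'I_N -> measure_display}
    {X : forall i, measurableType (dX i)} (dist : forall i, X i -> X i -> R)
    (p : \bar R) (c : ProdX X -> R) (L : R)
    (mu mu' : forall i, probability (X i) R) : Prop :=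
  forall pi pi', is_coupling mu pi -> is_coupling mu' pi' ->
    (`| \int[pi]_x (c x)%:E - \int[pi']_x (c x)%:E | <= L%:E * WX dist p pi pi')%E.

Definition cond_I {R : realType} {N : nat} {dX : 'I_N -> measure_display}
    {X : forall i, measurableType (dX i)} (dist : forall i, X i -> X i -> R)
    (q : R) (Cq : R) (mu : forall i, probability (X i) R) : Prop :=
  forall pi th, is_coupling mu pi -> is_coupling mu th ->
    (WX dist q%:E pi th <= Cq%:E * (KL th pi) `^ (2 * q)^-1)%E.

Definition cond_I' {R : realType} {N : nat} {dX : 'I_N -> measure_display}
    {X : forall i, measurableType (dX i)} (dist : forall i, X i -> X i -> R)
    (q : R) (Cq : R) (mu : forall i, probability (X i) R) : Prop :=
  forall pi th, is_coupling mu pi -> is_coupling mu th ->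
    (WX dist q%:E pi th <=
       Cq%:E * ((KL th pi) `^ q^-1 + (KL th pi * (2^-1)%:E) `^ (2 * q)^-1))%E.

Definition Delta {R : realType} {N : nat} {dX : 'I_N -> measure_display}
    {X : forall i, measurableType (dX i)} (dist : forall i, X i -> X i -> R)
    (p : \bar R) (mu mu' : forall i, probability (X i) R) : \bar R :=
  match p with
  | p'%:E => ((\sum_(i < N) (Wass (dist i) p (mu i) (mu' i)) `^ p') `^ p'^-1)%E
  | _ => (\big[Order.max/0%E]_(i < N) Wass (dist i) p (mu i) (mu' i))%E
  end.

(* Main.v *)
Require Import Defs.
From HB Require Import structures.
From mathcomp Require Import all_boot all_order all_algebra.
From mathcomp Require Import all_classical all_reals all_analysis ess_sup_inf.
From mathcomp Require Import measurable_realfun ring lra.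
Import Order.TTheory GRing.Theory Num.Theory.
Import numFieldNormedType.Exports.
Local Open Scope classical_set_scope.
Local Open Scope ring_scope.

(* Fix a real M > Delta and couplings gamma_i of mu'_i and mu_i whose joint cost
   is at most M. The optimizer pi'* has a density f with respect to the product
   P' of the mu'_i; weighting the product of the gamma_i by f yields a coupling
   of pi'* with a "shadow" sh in Pi(mu), at W_p-distance at most M and
   W_q-distance at most N^(1/q-1/p) M, and convexity of t ln t gives
   KL(sh, P) <= KL(pi'*, P'). Together with (A_L), and the same construction in
   the other direction, sh is optimal for S_ent(mu, c) up to 2 L M. Csiszar's
   Pythagorean inequality turns this into KL(sh, pi* ) <= 2 L M, the
   transport-entropy inequality bounds W_q(pi*, sh), the triangle inequality
   concludes, and finally M decreases to Delta.

   Neither the shadow nor the triangle inequality uses disintegration: the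
   former reweights a product measure, and the latter glues couplings along a
   countable partition of the intermediate space into cells of small diameter. *)

(** * Densities and images of measures *)

(** The shadow is there because the transport-entropy hypothesis compares only couplings of [mu],
    while the other optimizer couples [mu']. Its W_p-distance feeds (A_L); its W_q-distance enters
    the final triangle inequality. The Pythagorean inequality is optimality along the segment from
    the optimizer to the shadow: the cost is linear along it, so the defect in the convexity of
    entropy is all that remains, and as the segment shrinks to the optimizer this defect becomes the
    relative entropy of the shadow with respect to the optimizer, in the order of arguments that
    (I_q) asks for.

    A real M > Delta is used because the infima that define the Wasserstein distances need not be
    attained. The entropy part is shaped by two obstacles. First, t ln t takes both signs, so
    integrands are shifted or completed to nonnegative ones before integrals are added or compared.
    Second, ln 0 = 0 by convention, so tangent inequalities fail where a density vanishes, and such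
    sets are shown to be null or treated apart. *)

Section density.
Local Open Scope ereal_scope.
Context {d} {T : measurableType d} {R : realType}.

Section build.
Variables (m : set T -> \bar R) (m0 : m set0 = 0) (mge0 : forall A, 0 <= m A).
Hypotheses (ms : semi_sigma_additive m).

(** The existential form hides the packed structure: later arguments build a measure from a formula
    and then know it only through its values. *)
Lemma exists_finite_measure : m setT < +oo ->
  exists nu : {finite_measure set T -> \bar R}, forall A, nu A = m A.
Proof.
move=> moo.
pose M1 := isMeasure.Build _ _ _ m m0 mge0 ms.
pose M := (HB.pack_for {measure set T -> \bar R} m M1).
have fM : fin_num_fun m by apply: (@lty_fin_num_fun _ _ _ M).
pose F1 := Measure_isFinite.Build _ _ _ M fM.
by exists (HB.pack_for {finite_measure set T -> \bar R} m M1 F1).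
Qed.

Lemma exists_probability : m setT = 1 ->
  exists nu : probability T R, forall A, nu A = m A.
Proof.
move=> m1.
pose M1 := isMeasure.Build _ _ _ m m0 mge0 ms.
pose M := (HB.pack_for {measure set T -> \bar R} m M1).
pose F1 := Measure_isProbability.Build _ _ _ M m1.
by exists (HB.pack_for (probability T R) m M1 F1).
Qed.
End build.

Lemma pushforward_probability {d'} {T' : measurableType d'}
    (mu : probability T' R) (f : T' -> T) : measurable_fun setT f ->
  exists nu : probability T R, forall A, nu A = mu (f @^-1` A).
Proof.
move=> mf; pose f' := mfun_Sub (mem_set mf).
by exists (distribution mu f').
Qed.

Lemma ge0_integral_image {d'} {T' : measurableType d'}
    (mu : {measure set T' -> \bar R}) (nu : {measure set T -> \bar R})
    (phi : T' -> T) (h : T -> \bar R) : measurable_fun setT phi ->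
  (forall A, measurable A -> nu A = mu (phi @^-1` A)) ->
  measurable_fun setT h -> (forall x, 0 <= h x) ->
  \int[nu]_x h x = \int[mu]_x h (phi x).
Proof.
move=> mphi nuE mh h0.
have h0' : {in setT, forall y, 0 <= h y} by move=> y _.
have H := @ge0_integral_pushforward _ _ _ _ _ phi mphi mu setT h measurableT mh h0'.
rewrite preimage_setT in H; rewrite -H.
by apply: eq_measure_integral => A mA _; exact: nuE.
Qed.

Lemma density_finite_measure (mu : {measure set T -> \bar R}) (f : T -> R) :
  measurable_fun setT f -> (forall x, (0 <= f x)%R) ->
  \int[mu]_x (f x)%:E < +oo ->
  exists nu : {finite_measure set T -> \bar R},
    forall A, nu A = \int[mu]_(x in A) (f x)%:E.
Proof.
move=> mf f0 fi; apply: exists_finite_measure => //.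
- exact: integral_set0.
- by move=> A; apply: integral_ge0 => x _; rewrite lee_fin.
- by apply: semi_sigma_additive_nng_induced => //; exact/measurable_EFinP.
Qed.

Lemma density_probability (mu : {measure set T -> \bar R}) (f : T -> R) :
  measurable_fun setT f -> (forall x, (0 <= f x)%R) ->
  \int[mu]_x (f x)%:E = 1 ->
  exists nu : probability T R, forall A, nu A = \int[mu]_(x in A) (f x)%:E.
Proof.
move=> mf f0 fi; apply: exists_probability => //.
- exact: integral_set0.
- by move=> A; apply: integral_ge0 => x _; rewrite lee_fin.
- by apply: semi_sigma_additive_nng_induced => //; exact/measurable_EFinP.
Qed.

Lemma exists_density (nu : {finite_measure set T -> \bar R})
    (mu : {sigma_finite_measure set T -> \bar R}) :
  (forall A, measurable A -> mu A = 0 -> nu A = 0) ->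
  exists f : T -> R, [/\ measurable_fun setT f, forall x, (0 <= f x)%R &
    forall A, measurable A -> nu A = \int[mu]_(x in A) (f x)%:E].
Proof.
move=> numu; have : nu `<< mu by apply/null_content_dominatesP => A mA; exact: numu.
move=> /radon_nikodym_sigma_finite[f [f0 ffin fi fE]].
exists (fine \o f); split.
- exact: measurableT_comp (measurable_int _ fi).
- by move=> x; exact: fine_ge0.
- move=> A mA; rewrite fE//; apply: eq_integral => x _.
  by rewrite /= fineK.
Qed.

Section change.
Variables (nu : {finite_measure set T -> \bar R})
  (mu : {sigma_finite_measure set T -> \bar R}) (f : T -> R).
Hypotheses (mf : measurable_fun setT f) (f0 : forall x, (0 <= f x)%R).
Hypothesis nuE : forall A, measurable A -> nu A = \int[mu]_(x in A) (f x)%:E.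

Lemma density_integrable : mu.-integrable setT (EFin \o f).
Proof.
apply/integrableP; split; first exact/measurable_EFinP.
rewrite (eq_integral (EFin \o f)); last first.
  by move=> x _ /=; rewrite ger0_norm.
by rewrite -nuE// ltey_eq fin_num_measure.
Qed.

(** The change of variables is known for the Radon-Nikodym derivative of [nu]; [f] equals it almost
    everywhere because both have the same integral over every measurable set. *)
Lemma ge0_integral_density (h : T -> \bar R) : measurable_fun setT h ->
  (forall x, 0 <= h x) -> \int[nu]_x h x = \int[mu]_x (h x * (f x)%:E).
Proof.
move=> mh h0.
have numu : nu `<< mu.
  apply/null_content_dominatesP => A mA A0.
  rewrite nuE// ; apply: null_set_integral => //.
  exact/measurable_funTS/measurable_EFinP.
rewrite -(Radon_Nikodym_SigmaFinite.change_of_variables numu)//.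
have mF := Radon_Nikodym_SigmaFinite.f_integrable numu.
apply: ae_eq_integral => //.
- by apply: emeasurable_funM => //; exact: measurable_int mF.
- by apply: emeasurable_funM => //; exact/measurable_EFinP.
- have := @integral_ae_eq _ _ _ mu setT measurableT _ _ density_integrable (measurable_int _ mF).
  move=> H; have {}H : ae_eq mu setT (EFin \o f) (Radon_Nikodym_SigmaFinite.f nu mu).
    apply: H => E _ mE.
    by rewrite -(Radon_Nikodym_SigmaFinite.f_integral numu)// nuE.
  apply: filterS H => x /= H Dx; by rewrite -H.
Qed.

Lemma density_ae_unique (g : T -> R) : measurable_fun setT g ->
  (forall A, measurable A -> nu A = \int[mu]_(x in A) (g x)%:E) ->
  {ae mu, forall x, f x = g x}.
Proof.
move=> mg gE.
have H : ae_eq mu setT (EFin \o f) (EFin \o g).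
  apply: integral_ae_eq => //; first exact: density_integrable.
    exact/measurable_EFinP.
  by move=> E _ mE; rewrite -nuE// gE.
by apply: filterS H => x /(_ I)[].
Qed.

End change.
End density.

(** * Finite products of probability spaces *)

Section product_space.
Context {R : realType} {N : nat} {dX : 'I_N -> measure_display}.
Context {X : forall i, measurableType (dX i)}.

Definition box (A : forall i, set (X i)) : set (ProdX X) :=
  [set x | forall i, A i (x i)].

Lemma measurable_proj (i : 'I_N) :
  measurable_fun setT (fun x : ProdX X => x i).
Proof.
move=> _ A mA; rewrite setTI; apply: sub_sigma_algebra.
by exists i, A.
Qed.

Lemma measurable_fun_ProdX {d'} {U : measurableType d'} (f : U -> ProdX X) :
  (forall i, measurable_fun setT (fun u => f u i)) -> measurable_fun setT f.
Proof.
move=> mf; apply: (@measurability _ _ U (ProdX X) setT f (cylinders X)) => //.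
move=> _ [_ [i [A [mA ->]]] <-].
exact: (mf i measurableT A mA).
Qed.

Lemma box_bigcap (A : forall i, set (X i)) :
  box A = \bigcap_(i in [set: 'I_N]) [set x : ProdX X | A i (x i)].
Proof.
apply/seteqP; split => [x Ax i _|x Ax i]; first exact: Ax.
exact: Ax.
Qed.

Lemma measurable_box (A : forall i, set (X i)) :
  (forall i, measurable (A i)) -> measurable (box A).
Proof.
move=> mA; rewrite box_bigcap; apply: fin_bigcap_measurable => // i _.
by rewrite -[X in measurable X]setTI; exact: measurable_proj.
Qed.

Lemma product_measure_box (m : forall i, probability (X i) R) P :
  is_product_measure m P -> forall A, (forall i, measurable (A i)) ->
  P (box A) = (\prod_(i < N) m i (A i))%E.
Proof. by move=> mP A mA; exact: mP. Qed.

Lemma boxI (A B : forall i, set (X i)) :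
  box A `&` box B = box (fun i => A i `&` B i).
Proof.
apply/seteqP; split => [x [xA xB] i|x xAB]; first by split.
by split => i; have [] := xAB i.
Qed.

Lemma measurable_dfwith (A : forall i, set (X i)) j (B : set (X j)) :
  (forall i, measurable (A i)) -> measurable B ->
  forall i, measurable (dfwith A j B i).
Proof.
by move=> mA mB i; have [<-|ji] := eqVneq j i; rewrite ?dfwithin// dfwithout.
Qed.

Lemma cylinder_box j (B : set (X j)) :
  [set x : ProdX X | B (x j)] = box (dfwith (fun=> setT) j B).
Proof.
apply/seteqP; split => [x xB i|x /(_ j)]; last by rewrite dfwithin.
by have [<-|ji] := eqVneq j i; rewrite ?dfwithin// dfwithout.
Qed.

(** Boxes are stable under intersection and, every cylinder being a box, generate the product
    sigma-algebra. *)
Lemma measure_unique_box (m1 m2 : {finite_measure set (ProdX X) -> \bar R}) :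
  (forall A : forall i, set (X i), (forall i, measurable (A i)) ->
    m1 (box A) = m2 (box A)) ->
  forall A, measurable A -> m1 A = m2 A.
Proof.
move=> m12.
pose G : set (set (ProdX X)) :=
  [set B | exists A, (forall i, measurable (A i)) /\ B = box A].
apply: (@measure_unique _ R (ProdX X) G (fun=> setT)).
- apply/seteqP; split => [A mA|A].
    apply: mA; split; first exact: smallest_sigma_algebra.
    move=> _ [j [B [mB ->]]]; apply: sub_sigma_algebra.
    exists (dfwith (fun=> setT) j B); split; last exact: cylinder_box.
    exact: measurable_dfwith.
  apply; split; first exact: sigma_algebra_measurable.
  by move=> _ [B [mB ->]]; exact: measurable_box.
- move=> _ _ [A [mA ->]] [B [mB ->]].
  exists (fun i => A i `&` B i); split; last exact: boxI.
  by move=> i; exact: measurableI.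
- move=> _; exists (fun=> setT); split => //.
  by apply/seteqP; split.
- by rewrite bigcup_const.
- by move=> _ [A [mA ->]]; exact: m12.
- by move=> _; rewrite ltey_eq fin_num_measure.
Qed.

Lemma measurable_update j :
  measurable_fun setT (fun z : ProdX X * X j => dfwith z.1 j z.2 : ProdX X).
Proof.
apply: measurable_fun_ProdX => i; have [<-|ji] := eqVneq j i.
  apply: (eq_measurable_fun snd); last exact: measurable_snd.
  by move=> z _; rewrite dfwithin.
apply: (eq_measurable_fun (fun z : ProdX X * X j => z.1 i)).
  by move=> z _; rewrite dfwithout.
exact: (measurableT_comp (measurable_proj i) measurable_fst).
Qed.

(** The new measure is the image of [P \x nu] under overwriting coordinate [j]. *)
Lemma product_measure_update (m : forall i, probability (X i) R) P j
    (nu : probability (X j) R) : is_product_measure m P ->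
  exists Q, is_product_measure (dfwith m j nu) Q.
Proof.
move=> mP.
have [Q QE] := pushforward_probability (P \x nu)%E _ (measurable_update j).
exists Q => A mA; rewrite QE.
have -> : (fun z : ProdX X * X j => dfwith z.1 j z.2 : ProdX X) @^-1`
    [set x | forall i, A i (x i)] = box (dfwith A j setT) `*` A j.
  apply/seteqP; split => [[x t] /= xA|[x t] [/= xA tA] i].
    split => /=; last by have := xA j; rewrite dfwithin.
    move=> i /=; have [<-|ji] := eqVneq j i; first by rewrite dfwithin.
    by have := xA i; rewrite !dfwithout.
  have [<-|ji] := eqVneq j i; first by rewrite dfwithin.
  by have := xA i; rewrite !dfwithout.
have mAT : forall i, measurable (dfwith A j setT i) by exact: measurable_dfwith.
rewrite /= product_measure1E//; last exact: measurable_box.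
rewrite [X in (X * _)%E](product_measure_box _ _ mP)// (bigD1 j)//=.
rewrite [in RHS](bigD1 j)//= !dfwithin probability_setT mul1e.
rewrite muleC; congr (_ * _)%E; apply: eq_bigr => i ij.
by rewrite !dfwithout// eq_sym.
Qed.

(** The induction starts from a Dirac mass, which is the product of Dirac masses, and replaces its
    factors one at a time, so the dependent type of the product never changes. *)
Lemma exists_product_measure (nu : forall i, probability (X i) R) :
  exists Q, is_product_measure nu Q.
Proof.
suff [m [Q [mQ mnu]]] : exists (m : forall i, probability (X i) R)
    (Q : probability (ProdX X) R), is_product_measure m Q /\
    forall i, i \in index_enum 'I_N -> m i = nu i.
  exists Q => A mA; rewrite mQ//; apply: eq_bigr => i _.
  by rewrite mnu// mem_index_enum.
elim: (index_enum _) => [|j s [m [Q [mQ mnu]]]].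
  pose x0 : ProdX X := fun i => point.
  exists (fun i => \d_(point : X i)), \d_x0; split => // A mA.
  rewrite /= diracE; case: (boolP (x0 \in _)) => [/set_mem xA|/negP xA].
    rewrite big1// => i _.
    by rewrite /= diracE (mem_set (xA i)).
  have [i iA] : exists i, ~ A i (x0 i).
    by apply/existsNP => xA'; apply: xA; apply/mem_set.
  rewrite (bigD1 i)//= diracE; case: (boolP (_ \in _)) => [/set_mem//|_].
  by rewrite mul0e.
have [Q' mQ'] := product_measure_update _ _ j (nu j) mQ.
exists (dfwith m j (nu j)), Q'; split => // i; rewrite inE.
have [<-|ji] := eqVneq j i; first by rewrite dfwithin.
by move=> /= si; rewrite dfwithout// mnu.
Qed.

Lemma product_measure_coupling (m : forall i, probability (X i) R) P :
  is_product_measure m P -> is_coupling m P.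
Proof.
move=> mP i A mA; rewrite cylinder_box (product_measure_box _ _ mP); last exact: measurable_dfwith.
rewrite (bigD1 i)//= dfwithin big1 ?mule1// => j ji.
by rewrite dfwithout 1?eq_sym// probability_setT.
Qed.

Lemma integral_coupling (m : forall i, probability (X i) R) P i
  (f : X i -> \bar R) : is_coupling m P -> measurable_fun setT f ->
  (forall x, 0 <= f x)%E -> (\int[P]_x f (x i) = \int[m i]_x f x)%E.
Proof.
move=> mP mf f0.
apply/esym/ge0_integral_image => //; first exact: measurable_proj.
by move=> A mA; apply/esym; exact: (mP i A mA).
Qed.

(** Restrict [P] by the conditions on the coordinates other than [j], then project to coordinate
    [j]: the result is a multiple of [m j], with the product on the right as factor. *)
Lemma integral_product_coord (m : forall i, probability (X i) R) P j
    (f : X j -> R) (A : forall i, set (X i)) : is_product_measure m P ->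
  measurable_fun setT f -> (forall x, 0 <= f x) ->
  (forall i, measurable (A i)) ->
  (\int[P]_(x in box A) (f (x j))%:E =
   (\int[m j]_(x in A j) (f x)%:E) * \prod_(i < N | i != j) m i (A i))%E.
Proof.
move=> mP mf f0 mA.
pose B := box (dfwith A j setT).
have mB : measurable B by apply: measurable_box; exact: measurable_dfwith.
pose c := (\prod_(i < N | i != j) m i (A i))%E.
have c0 : (0 <= c)%E by apply: prode_ge0 => i _; exact: measure_ge0.
have cfin : c \is a fin_num.
  by apply: prode_fin_num => i _; rewrite fin_num_measure.
transitivity (\int[mscale (NngNum (fine_ge0 c0)) (m j)]_(x in A j) (f x)%:E)%E; last first.
  rewrite ge0_integral_mscale//.
  - by rewrite /= fineK// muleC.
  - exact/measurable_funTS/measurable_EFinP.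
  - by move=> x _; rewrite lee_fin.
have mBi : measurable_fun setT (\1_B : ProdX X -> R) by exact: measurable_indic.
have [nu nuE] : exists nu : {finite_measure set (ProdX X) -> \bar R},
    forall C, nu C = (\int[P]_(x in C) (\1_B x)%:E)%E.
  apply: density_finite_measure => //.
  by rewrite integral_indic// setIT ltey_eq fin_num_measure.
have mCj : measurable [set x : ProdX X | A j (x j)].
  by rewrite -[X in measurable X]setTI; exact: measurable_proj.
have mfj : measurable_fun setT (fun x : ProdX X => f (x j)).
  exact: (measurableT_comp mf (measurable_proj j)).
rewrite [RHS]integral_mkcond.
rewrite (@ge0_integral_image _ _ _ _ _ nu _ (fun x : ProdX X => x j)); first last.
- by move=> x; rewrite patchE; case: ifPn => // _; rewrite lee_fin.
- apply/(measurable_restrictT _ (mA j)).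
  exact/measurable_funTS/measurable_EFinP.
- move=> C mC; rewrite [RHS]nuE integral_indic//; last first.
    by rewrite -[X in measurable X]setTI; exact: measurable_proj.
  transitivity (P (box (fun i => dfwith (fun=> setT) j C i `&` dfwith A j setT i))); last first.
    by rewrite -boxI -cylinder_box setIC.
  rewrite (product_measure_box _ _ mP); last first.
    by move=> i; apply: measurableI; exact: measurable_dfwith.
  rewrite -[LHS]/((fine c)%:E * m j C)%E fineK// muleC (bigD1 j)//=.
  rewrite !dfwithin setIT; congr (_ * _)%E.
  by apply: eq_bigr => i ij; rewrite !dfwithout 1?eq_sym// setTI.
- exact: measurable_proj.
rewrite (@ge0_integral_density _ _ _ nu P \1_B)//; first last.
- by move=> x; rewrite patchE; case: ifPn => // _; rewrite lee_fin.
- apply: (measurableT_comp _ (measurable_proj j)).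
  apply/(measurable_restrictT _ (mA j)).
  exact/measurable_funTS/measurable_EFinP.
rewrite integral_mkcond; apply: eq_integral => x _; rewrite !patchE/=.
have -> : (x \in box A) = (x j \in A j) && (x \in B).
  apply/idP/andP => [/set_mem xA|[/set_mem/= xj /set_mem xB]].
    split; apply/mem_set => //= i.
    by have [<-|ji] := eqVneq j i; rewrite ?dfwithin// dfwithout.
  apply/mem_set => i; have [<-//|ji] := eqVneq j i.
  by have := xB i; rewrite dfwithout.
by rewrite indicE; case: (_ \in _); case: (_ \in _); rewrite ?mule0 ?mule1 ?mul0e.
Qed.
End product_space.

(** * Separable metrics *)

Section separable_metric.
Context {d} {T : measurableType d} {R : realType}.
Variable dist : T -> T -> R.
Hypothesis Hdist : polish_borel dist.

Lemma measurable_dist1 (a : T) : measurable_fun setT (dist a).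
Proof.
have [[_ _ _ dD] _ _ mE] := Hdist.
apply: (measurability _ (RGenInftyO.measurableE R)) => // _ [_ [r ->] <-].
rewrite setTI mE; apply: sub_sigma_algebra => x /=; rewrite in_itv/= => xr.
exists (r - dist a x); split; first by rewrite subr_gt0.
by move=> y xy; rewrite in_itv/= (le_lt_trans (dD _ x _))// -ltrBrDl.
Qed.

Lemma dense_sequence :
  exists s : nat -> T, forall x (e : R), 0 < e -> exists n, dist x (s n) < e.
Proof.
have [_ _ [D [cD dD]] _] := Hdist.
have [D0|[f]] := pfcard_geP cD.
  by have [y []] := dD point 1 ltr01; rewrite D0.
exists f => x e e0; have [y [Dy xy]] := dD x e e0.
have fs : set_surj setT D f by exact: surj.
by have [n _ fny] := fs y Dy; exists n; rewrite fny.
Qed.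

(** Separability makes the distance measurable for the product sigma-algebra: two points are closer
    than r exactly when their distances to some point of the dense sequence add up to less than
    r. *)
Lemma measurable_dist : measurable_fun setT (fun z : T * T => dist z.1 z.2).
Proof.
have [[_ _ dC dD] _ _ _] := Hdist; have [s sP] := dense_sequence.
apply: (measurability _ (RGenInftyO.measurableE R)) => // _ [_ [r ->] <-].
rewrite setTI; have -> : (fun z : T * T => dist z.1 z.2) @^-1` `]-oo, r[ =
    \bigcup_n [set z : T * T | dist (s n) z.1 + dist (s n) z.2 < r].
  apply/seteqP; split => [[x y] /=|[x y] [n _] /=]; rewrite in_itv/=.
    move=> xyr; have e0 : 0 < (r - dist x y) / 2 by rewrite divr_gt0// subr_gt0.
    have [n xn] := sP x _ e0; exists n => //=; rewrite dC.
    have := dD (s n) x y; rewrite (dC (s n) x); move: xn.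
    by move: (dist x (s n)) (dist _ y) (dist x y) => a b c'; lra.
  by apply: le_lt_trans; rewrite (le_trans (dD _ (s n) _))// (dC x).
apply: bigcupT_measurable => n.
have := @measurable_fun_ltr _ (T * T)%type R setT
  (fun z => dist (s n) z.1 + dist (s n) z.2) (cst r).
move=> /(_ _ _ measurableT [set true] I); rewrite setTI; apply => //.
by apply: measurable_funD; apply: (measurableT_comp (measurable_dist1 (s n))).
Qed.

(* A countable measurable partition into cells of diameter at most [e], encoded
   as the index function of the cells. *)
Lemma exists_discretization (e : R) : 0 < e ->
  exists phi : T -> nat, (forall n, measurable (phi @^-1` [set n])) /\
    forall x y, phi x = phi y -> dist x y <= e.
Proof.
move=> e0; have [[_ _ dC dD] _ _ _] := Hdist; have [s sP] := dense_sequence.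
have ex x : exists n, dist (s n) x < e / 2.
  have e20 : 0 < e / 2 by rewrite divr_gt0.
  by have [n xn] := sP x _ e20; exists n; rewrite dC.
(* The index of [x] is that of the first ball of radius e / 2 about a dense point that contains [x],
   so two points of one cell share a centre. *)
exists (fun x => ex_minn (ex x)); split.
  move=> n.
  have mB k : measurable [set x | dist (s k) x < e / 2].
    have := @measurable_fun_ltr _ T R setT (dist (s k)) (cst (e / 2)).
    move=> /(_ _ _ measurableT [set true] I); rewrite setTI; apply => //.
    exact: measurable_dist1.
  have -> : (fun x => ex_minn (ex x)) @^-1` [set n] =
      [set x | dist (s n) x < e / 2] `\`
      \bigcup_(k in `I_n) [set x | dist (s k) x < e / 2].
    apply/seteqP; split => [x /=|x /= [xn xk]].
      case: ex_minnP => m mx mmin <-; split => // -[k /= km kx].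
      by have := mmin k kx; rewrite leqNgt km.
    case: ex_minnP => m mx mmin; apply/eqP; rewrite eqn_leq mmin//=.
    by rewrite leqNgt; apply/negP => mn; apply: xk; exists m.
  by apply: measurableD => //; apply: bigcup_measurable => k _.
move=> x y; case: ex_minnP => m mx _; case: ex_minnP => n ny _ mn.
rewrite (le_trans (dD _ (s n) _))// (dC x) -mn.
by move: mx ny; rewrite -mn; move: (dist _ x) (dist _ y) => a b; lra.
Qed.

End separable_metric.

(** * Product metrics *)

Section finite_minkowski.
Context {R : realType}.

(** This is Minkowski's inequality in L^q for the counting measure on {0, ..., N-1}, a sum of Dirac
    masses on [nat]; [ext] extends a family on ['I_N] by 0. *)
Lemma minkowski_sum (N : nat) (a b : 'I_N -> R) (q : R) : 1 <= q ->
  (forall i, 0 <= a i) -> (forall i, 0 <= b i) ->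
  (\sum_(i < N) (a i + b i) `^ q) `^ q^-1 <=
  (\sum_(i < N) a i `^ q) `^ q^-1 + (\sum_(i < N) b i `^ q) `^ q^-1.
Proof.
move=> q1 a0 b0.
pose ext (f : 'I_N -> R) (k : nat) : R := if insub k is Some i then f i else 0.
have extE f (i : 'I_N) : ext f i = f i by rewrite /ext valK.
have mext f : measurable_fun setT (ext f) by [].
pose m : {measure set nat -> \bar R} := msum (fun k : nat => \d_k) N.
have normE f : (forall i, 0 <= f i) ->
    Lnorm m q%:E (EFin \o ext f) = ((\sum_(i < N) f i `^ q) `^ q^-1)%:E.
  move=> f0; rewrite unlock ge0_integral_measure_sum//; last first.
    by move=> k _; exact: poweR_ge0.
  rewrite -poweR_EFin; congr (_ `^ _)%E; rewrite -sumEFin; apply: eq_bigr => i _.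
  by rewrite integral_dirac//= diracT mul1e extE ger0_norm.
have abE : (ext a \+ ext b)%R = ext (fun i => a i + b i).
  by apply/funext => k; rewrite /ext /=; case: insub => //; rewrite addr0.
have := @minkowski_EFin _ _ _ m (ext a) (ext b) q (mext a) (mext b) q1.
have ab0 i : 0 <= a i + b i by exact: addr_ge0.
rewrite abE (normE a)// (normE b)// (normE _ ab0).
by rewrite -EFinD lee_fin.
Qed.
End finite_minkowski.

Section product_metric.
Context {R : realType} {N : nat} {dX : 'I_N -> measure_display}.
Context {X : forall i, measurableType (dX i)}.
Variable dist : forall i, X i -> X i -> R.
Hypothesis Hdist : forall i, polish_borel (dist i).

Let dist_ge0 i x y : 0 <= dist i x y.
Proof. by have [[]] := Hdist i. Qed.

Lemma dXr_ge0 r (x y : ProdX X) : 0 <= dXr dist r x y.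
Proof.
case: r => [r| |] /=; first exact: powR_ge0.
- by elim/big_ind : _ => // a b a0 b0; rewrite le_max a0.
- by elim/big_ind : _ => // a b a0 b0; rewrite le_max a0.
Qed.

Lemma dXr_sym r (x y : ProdX X) : dXr dist r x y = dXr dist r y x.
Proof.
by case: r => [r| |] /=; [congr (_ `^ _)| |]; apply: eq_bigr => i _;
  have [[_ _ -> _] _ _ _] := Hdist i.
Qed.

Lemma dXr_triangle (q : R) (x y z : ProdX X) : 1 <= q ->
  dXr dist q%:E x z <= dXr dist q%:E x y + dXr dist q%:E y z.
Proof.
move=> q1 /=; apply: le_trans (minkowski_sum _ _ _ _ q1 _ _) => //.
have q0 : 0 < q by rewrite (lt_le_trans ltr01).
apply: ge0_ler_powR; rewrite ?nnegrE ?invr_ge0 ?(ltW q0)//.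
- by apply: sumr_ge0 => i _; exact: powR_ge0.
- by apply: sumr_ge0 => i _; exact: powR_ge0.
apply: ler_sum => i _; apply: ge0_ler_powR; rewrite ?nnegrE ?(ltW q0) ?addr_ge0//.
by have [[_ _ _ dD] _ _ _] := Hdist i.
Qed.

Lemma measurable_dist_coord i :
  measurable_fun setT (fun z : ProdX X * ProdX X => dist i (z.1 i) (z.2 i)).
Proof.
have mp : measurable_fun setT (fun z : ProdX X * ProdX X => (z.1 i, z.2 i)).
  apply: measurable_fun_pair.
    exact: (measurableT_comp (measurable_proj i) measurable_fst).
  exact: (measurableT_comp (measurable_proj i) measurable_snd).
exact: (measurableT_comp (measurable_dist _ (Hdist i)) mp).
Qed.

Lemma measurable_dXr (r : R) :
  measurable_fun setT (fun z : ProdX X * ProdX X => dXr dist r%:E z.1 z.2).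
Proof.
apply: (measurableT_comp (measurable_powR _)).
by apply: measurable_sum => i; apply: (measurableT_comp (measurable_powR _));
  exact: measurable_dist_coord.
Qed.

(** Cells of the product are products of cells; [pickle] codes the finite tuple of their indices as
    one natural number. *)
Lemma exists_discretization_ProdX (e : R) : 0 < e ->
  exists phi : ProdX X -> nat, (forall n, measurable (phi @^-1` [set n])) /\
    forall x y, phi x = phi y -> forall i, dist i (x i) (y i) <= e.
Proof.
move=> e0.
pose phi i := sval (cid (exists_discretization _ (Hdist i) e e0)).
have phiP i : (forall n, measurable (phi i @^-1` [set n])) /\
    forall x y, phi i x = phi i y -> dist i x y <= e.
  by rewrite /phi; case: cid.
exists (fun x => pickle [ffun i => phi i (x i)]); split; last first.
  move=> x y /(pcan_inj pickleK) xy i; have [_] := phiP i; apply.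
  by have := congr1 (fun f : {ffun 'I_N -> nat} => f i) xy; rewrite !ffunE.
move=> n; have [[k kn]|nex] := pselect (exists k : {ffun 'I_N -> nat}, pickle k = n); last first.
  rewrite (_ : _ @^-1` _ = set0)//; apply/seteqP; split => // x /= xn.
  by apply: nex; eexists; exact: xn.
rewrite (_ : _ @^-1` _ = box (fun i => phi i @^-1` [set k i])); last first.
  apply/seteqP; split => [x /=|x xk] /=.
    rewrite -kn => /(pcan_inj pickleK) xk i /=.
    by have := congr1 (fun f : {ffun 'I_N -> nat} => f i) xk; rewrite !ffunE.
  by rewrite -kn; congr pickle; apply/ffunP => i; rewrite ffunE xk.
by apply: measurable_box => i; have [] := phiP i.
Qed.

Lemma exists_discretization_dXr (q : R) (e : R) : 1 <= q -> 0 < e ->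
  exists phi : ProdX X -> nat, (forall n, measurable (phi @^-1` [set n])) /\
    forall x y, phi x = phi y -> dXr dist q%:E x y <= e.
Proof.
move=> q1 e0; have q0 : 0 < q by rewrite (lt_le_trans ltr01).
(* N^(1/q) compares the largest coordinate distance with d_{X,q}; the added 1 keeps [c] positive
   when N = 0. *)
pose c : R := N%:R `^ q^-1 + 1.
have c0 : 0 < c by rewrite ltr_wpDl ?powR_ge0.
have [phi [mphi phiE]] := exists_discretization_ProdX _ (divr_gt0 e0 c0).
exists phi; split => // x y /phiE xy.
have ec0 : 0 <= e / c by rewrite divr_ge0 ?ltW.
apply: (@le_trans _ _ ((\sum_(i < N) (e / c) `^ q) `^ q^-1)).
  apply: ge0_ler_powR; rewrite ?nnegrE ?invr_ge0 ?(ltW q0)//.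
  - by apply: sumr_ge0 => i _; exact: powR_ge0.
  - by apply: sumr_ge0 => i _; exact: powR_ge0.
  - by apply: ler_sum => i _; apply: ge0_ler_powR; rewrite ?nnegrE ?(ltW q0).
rewrite sumr_const card_ord -[X in X `^ _]mulr_natl powRM ?powR_ge0// -powRrM.
rewrite divff ?gt_eqF// powRr1// mulrCA ger_pMr// ler_pdivrMr// mul1r.
by rewrite lerDl.
Qed.

(** Continuity refers to the metric, measurability to the product sigma-algebra. Replacing x by a
    representative of its cell, with cells of mesh 1/(m+1), gives measurable functions that converge
    pointwise to [c]. *)
Lemma measurable_cost (c : ProdX X -> R) : cost_continuous dist c ->
  measurable_fun setT c.
Proof.
move=> cc.
have Vm0 (m : nat) : 0 < (m.+1%:R : R)^-1 by rewrite invr_gt0 ltr0n.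
have phiP (m : nat) := cid (exists_discretization_ProdX _ (Vm0 m)).
pose phi m := sval (phiP m).
(* The default [point] concerns empty cells only, and no x lies in one. *)
pose rep m n : ProdX X := xget point (phi m @^-1` [set n]).
have repE m x : phi m (rep m (phi m x)) = phi m x.
  exact: (@xgetPex _ point (phi m @^-1` [set phi m x]) (ex_intro _ x erefl)).
apply: (@measurable_fun_cvg _ _ _ setT (fun m x => c (rep m (phi m x)))) => //.
  move=> m.
  have mphi : measurable_fun setT (phi m : ProdX X -> nat).
    move=> _ B _; rewrite setTI (_ : _ @^-1` B = \bigcup_(n in B) (phi m @^-1` [set n])).
      by apply: bigcup_measurable => n _; have [] := svalP (phiP m).
    apply/seteqP; split => [x /= Bx|x /= [n Bn /= xn]].
      by exists (phi m x).
    by rewrite xn.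
  have mg : measurable_fun [set: nat] (fun n => c (rep m n)) by [].
  exact: (measurableT_comp mg mphi).
move=> x _; apply/cvgrPdist_lt => e e0.
have [del [del0 xdel]] := cc x e e0.
near=> m; apply: xdel => /=.
rewrite (@le_lt_trans _ _ (m.+1%:R^-1))//; last first.
  by near: m; exact: near_infty_natSinv_lt (PosNum del0).
have [_ mP] := svalP (phiP m).
elim/big_ind : _ => // [a b a0 b0|i _]; first by rewrite ge_max a0.
by apply: mP; rewrite -/(phi m) repE.
Unshelve. all: by end_near. Qed.

End product_metric.

(** * Wasserstein distances *)

Section wasserstein.
Context {d} {T : measurableType d} {R : realType}.
Variable dist : T -> T -> R.
Hypothesis dist_ge0 : forall x y, 0 <= dist x y.
Hypothesis mdist : measurable_fun setT (fun z : T * T => dist z.1 z.2).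
Implicit Types (mu nu rho : probability T R) (g : probability (T * T)%type R).

Lemma wcost_ge0 g (q : \bar R) : (0 <= wcost dist q g)%E.
Proof.
(* Positive mass keeps the essential supremum of a nonnegative function from being negative. *)
have g0 : (0 < g setT)%E by rewrite probability_setT.
case: q => [q| |] /=; first exact: poweR_ge0.
- by apply: ess_sup_gee => //; apply: nearW => z; rewrite lee_fin.
- by apply: ess_sup_gee => //; apply: nearW => z; rewrite lee_fin.
Qed.

Lemma Wass_ge0 mu nu (q : \bar R) : (0 <= Wass dist q mu nu)%E.
Proof. by apply/ereal_infP => _ [g [_ ->]]; exact: wcost_ge0. Qed.

Lemma Wass_symW mu nu (q : \bar R) : (forall x y, dist x y = dist y x) ->
  (Wass dist q mu nu <= Wass dist q nu mu)%E.
Proof.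
move=> dC; apply/ereal_infP => _ [g [gE ->]].
pose swap (z : T * T) := (z.2, z.1).
have mswap : measurable_fun setT swap.
  by apply: measurable_fun_pair; [exact: measurable_snd|exact: measurable_fst].
have [g' g'E] := pushforward_probability g _ mswap.
apply: (@le_trans _ _ (wcost dist q g')).
  apply: ereal_inf_lbound; exists g'; split => // A mA.
  have [g1 g2] := gE A mA; rewrite !g'E; split.
    rewrite -g2; congr (g _); apply/seteqP; split => [[x y] []|[x y] []] //.
  by rewrite -g1; congr (g _); apply/seteqP; split => [[x y] []|[x y] []].
have H : (ess_sup g' (fun z => (dist z.1 z.2)%:E) <= ess_sup g (fun z => (dist z.1 z.2)%:E))%E.
  apply/ess_supP.
  have [B [mB B0 BP]] := @ess_sup_ge _ _ _ g (fun z => (dist z.1 z.2)%:E).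
  exists (swap @^-1` B); split.
  - by rewrite -[X in measurable X]setTI; exact: mswap.
  - by rewrite [LHS]g'E (_ : _ @^-1` _ = B)//; apply/seteqP; split => -[].
  - by move=> [x y] /= xy; apply: BP => /=; rewrite -[dist y x]dC.
case: q => [q| |] //=.
rewrite (@ge0_integral_image _ _ _ _ _ g g' swap) => //.
- rewrite (eq_integral (fun z => (dist z.1 z.2 `^ q)%:E))// => z _.
  by rewrite /= dC.
- by move=> A mA; exact: g'E.
- apply/measurable_EFinP.
  exact: (measurableT_comp (measurable_powR _) mdist).
- by move=> z; rewrite lee_fin powR_ge0.
Qed.

Lemma Wass_sym mu nu (q : \bar R) : (forall x y, dist x y = dist y x) ->
  (Wass dist q mu nu = Wass dist q nu mu)%E.
Proof. by move=> dC; apply/eqP; rewrite eq_le !Wass_symW. Qed.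

(** * Gluing two couplings along a discretized middle space *)

Section glue.
Hypothesis dist_triangle : forall x y z, dist x z <= dist x y + dist y z.
Variables (q e : R) (q1 : 1 <= q) (e0 : 0 < e).
Variables (phi : T -> nat) (mphi : forall n, measurable (phi @^-1` [set n])).
Hypothesis phiE : forall x y, phi x = phi y -> dist x y <= e.
Variable nu : probability T R.

Let cell n := phi @^-1` [set n].
(** Null cells get the value 0, the inverse of 0 being 0; by [null_cells] all of them together carry
    no mass. *)
Let k n : R := (fine (nu (cell n)))^-1.

Let mphiT : measurable_fun setT (phi : T -> nat).
Proof.
move=> _ B _; rewrite setTI (_ : _ @^-1` B = \bigcup_(n in B) (phi @^-1` [set n])).
  by apply: bigcup_measurable => n _.
apply/seteqP; split => [x /= Bx|x /= [n Bn /= xn]]; first by exists (phi x).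
by rewrite xn.
Qed.

Let k_ge0 n : 0 <= k n. Proof. by rewrite invr_ge0 fine_ge0. Qed.

Let null_cells : nu [set x | nu (cell (phi x)) = 0%E] = 0%E.
Proof.
have -> : [set x | nu (cell (phi x)) = 0%E] =
    \bigcup_(n in [set n | nu (cell n) = 0%E]) cell n.
  apply/seteqP; split => [x x0|x [n n0 /= xn]]; first by exists (phi x).
  by rewrite /= xn.
have N : nu.-negligible (\bigcup_n (if nu (cell n) == 0%E then cell n else set0)).
  apply: negligible_bigcup => n; case: eqP => [n0|_].
    by exists (cell n); split => //; exact: mphi.
  exact: negligible_set0.
rewrite bigcup_mkcond; apply/negligibleP.
  apply: bigcup_measurable => n _; case: ifPn => // _; exact: mphi.
by apply: negligibleS N => x [n _ /= xn]; exists n => //; move: xn;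
  case: ifPn => [/set_mem/= ->|]; rewrite ?eqxx.
Qed.

Let cell_integral {d'} {S : measurableType d'} (g : probability S R) (p : S -> T)
    (n : nat) : measurable_fun setT p ->
  (forall A, measurable A -> g (p @^-1` A) = nu A) ->
  (\int[g]_b (k n * (n == phi (p b))%:R)%:E = (nu (cell n) != 0)%:R%:E)%E.
Proof.
move=> mp gp.
have mpn : measurable (p @^-1` cell n).
  by rewrite -[X in measurable X]setTI; exact: (mp measurableT _ (mphi n)).
rewrite (eq_integral (fun b => (k n)%:E * (\1_(p @^-1` cell n) b)%:E)%E); last first.
  move=> b _; rewrite EFinM indicE; congr (_ * (_ %:R)%:E)%E; congr nat_of_bool.
  by apply/eqP/idP => [->|/set_mem/= <-//]; exact: mem_set.
rewrite ge0_integralZl ?lee_fin//; last first.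
  exact/measurable_EFinP/measurable_indic.
rewrite integral_indic// setIT [X in (_ * X)%E](gp _ (mphi n)) /k.
case: eqP => [->|n0]; first by rewrite mule0.
have nf : nu (cell n) \is a fin_num by rewrite fin_num_measure//; exact: mphi.
rewrite -[X in (_ * X)%E](fineK nf) -EFinM mulVf// fine_eq0//.
exact/eqP.
Qed.

(* Density, with respect to the product of the two couplings, of the law that
   draws the two middle points independently within a common cell. *)
Let weight (u : (T * T) * (T * T)) : R := k (phi u.1.2) * (phi u.1.2 == phi u.2.1)%:R.

(** Symmetry in the two middle points lets [cell_integral] integrate out either coupling. *)
Let weightE (u : (T * T) * (T * T)) :
  weight u = k (phi u.2.1) * (phi u.2.1 == phi u.1.2)%:R.
Proof. by rewrite /weight eq_sym; case: eqP => [->//|]; rewrite !mulr0. Qed.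

Let mweight : measurable_fun setT weight.
Proof.
have m12 : measurable_fun setT (fun u : (T * T) * (T * T) => phi u.1.2).
  apply: (measurableT_comp mphiT).
  exact: (measurableT_comp measurable_snd measurable_fst).
have m21 : measurable_fun setT (fun u : (T * T) * (T * T) => phi u.2.1).
  apply: (measurableT_comp mphiT).
  exact: (measurableT_comp measurable_fst measurable_snd).
apply: measurable_funM.
  have mk : measurable_fun [set: nat] k by [].
  exact: (measurableT_comp mk m12).
have mb : measurable_fun [set: bool] (fun b : bool => b%:R : R) by [].
exact: (measurableT_comp mb (measurable_fun_eqn m12 m21)).
Qed.

Let weight_ge0 u : 0 <= weight u.
Proof. by rewrite mulr_ge0. Qed.

(** The extra factor is what [cell_integral] leaves behind; it is 1 outside the null cells, hence
    almost surely. *)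
Let null_marginal {d'} {S : measurableType d'} (g : probability S R) (p : S -> T)
    (h : S -> \bar R) : measurable_fun setT p ->
  (forall A, measurable A -> g (p @^-1` A) = nu A) ->
  measurable_fun setT h -> (forall x, 0 <= h x)%E ->
  (\int[g]_a (h a * (nu (cell (phi (p a))) != 0)%:R%:E) = \int[g]_a h a)%E.
Proof.
move=> mp gp mh h0.
have mc : measurable_fun setT (fun a => (nu (cell (phi (p a))) != 0%E)%:R%:E : \bar R).
  have mk : measurable_fun [set: nat] (fun n => (nu (cell n) != 0%E)%:R%:E : \bar R) by [].
  exact: (measurableT_comp mk (measurableT_comp mphiT mp)).
apply: ae_eq_integral => //; first exact: emeasurable_funM.
have mB : measurable [set x | nu (cell (phi x)) = 0%E].
  by rewrite -[X in measurable X]setTI; exact: (mphiT measurableT [set n | nu (cell n) = 0%E] I).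
exists (p @^-1` [set x | nu (cell (phi x)) = 0%E]); split.
- by rewrite -[X in measurable X]setTI; exact: mp.
- by rewrite [LHS]gp.
- move=> a /= /not_implyP[_ ha]; apply: contrapT => /eqP n0; apply: ha.
  by rewrite n0 mule1.
Qed.

(** The weight keeps [g1] and [g2] as marginals and forces the two middle points y, y' into one
    cell. There dist x z <= dist x y + e + dist y' z, and Minkowski's inequality in L^q of the
    weighted measure separates the three terms. *)
Lemma glue_couplings mu rho g1 g2 : coupling2 mu nu g1 -> coupling2 nu rho g2 ->
  exists g, coupling2 mu rho g /\
    (wcost dist q%:E g <= wcost dist q%:E g1 + e%:E + wcost dist q%:E g2)%E.
Proof.
move=> c1 c2.
have g1E A : measurable A -> g1 (snd @^-1` A) = nu A.
  move=> mA; have [_ <-] := c1 A mA; congr (g1 _).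
  by apply/seteqP; split => [[x y]|[x y] []].
have g2E A : measurable A -> g2 (fst @^-1` A) = nu A.
  move=> mA; have [<- _] := c2 A mA; congr (g2 _).
  by apply/seteqP; split => [[x y]|[x y] []].
pose gg : probability ((T * T) * (T * T))%type R := (g1 \x g2)%E.
have int1 (h : T * T -> \bar R) : measurable_fun setT h -> (forall x, 0 <= h x)%E ->
    (\int[gg]_u (h u.1 * (weight u)%:E) = \int[g1]_a h a)%E.
  move=> mh h0; rewrite [LHS]fubini_tonelli1//; first last.
  - by move=> u; rewrite mule_ge0// lee_fin.
  - apply: emeasurable_funM; first exact: (measurableT_comp mh measurable_fst).
    exact/measurable_EFinP.
  rewrite -(null_marginal g1 snd)//; apply: eq_integral => a _ /=.
  rewrite /fubini_F/= ge0_integralZl//; first last.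
  - by move=> b _; rewrite lee_fin.
  - apply/measurable_EFinP; exact: (measurableT_comp mweight (pair1_measurable a)).
  by congr (_ * _)%E; rewrite -(cell_integral g2 fst (phi a.2)).
have int2 (h : T * T -> \bar R) : measurable_fun setT h -> (forall x, 0 <= h x)%E ->
    (\int[gg]_u (h u.2 * (weight u)%:E) = \int[g2]_a h a)%E.
  move=> mh h0; rewrite [LHS]fubini_tonelli2//; first last.
  - by move=> u; rewrite mule_ge0// lee_fin.
  - apply: emeasurable_funM; first exact: (measurableT_comp mh measurable_snd).
    exact/measurable_EFinP.
  rewrite -(null_marginal g2 fst)//; apply: eq_integral => b _ /=.
  rewrite /fubini_G/= ge0_integralZl//; first last.
  - by move=> a _; rewrite lee_fin.
  - apply/measurable_EFinP; exact: (measurableT_comp mweight (pair2_measurable b)).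
  congr (_ * _)%E; rewrite -(cell_integral g1 snd (phi b.1))//.
  by apply: eq_integral => a _; rewrite weightE.
have [M ME] : exists M : probability ((T * T) * (T * T))%type R,
    forall A, M A = (\int[gg]_(u in A) (weight u)%:E)%E.
  apply: density_probability => //.
  transitivity (\int[g1]_a (cst 1%E a))%E; last first.
    by rewrite integral_cst// mul1e; exact: probability_setT.
  by rewrite -int1//; apply: eq_integral => u _; rewrite mul1e.
have MI (h : (T * T) * (T * T) -> \bar R) : measurable_fun setT h ->
    (forall x, 0 <= h x)%E ->
    (\int[M]_u h u = \int[gg]_u (h u * (weight u)%:E))%E.
  move=> mh h0.
  exact: (ge0_integral_density M gg weight mweight weight_ge0 (fun A _ => ME A) h mh h0).
have M1 A : measurable A -> g1 A = M (fst @^-1` A).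
  move=> mA; have mA' : measurable (fst @^-1` A : set ((T * T) * (T * T))).
    by rewrite -[X in measurable X]setTI; exact: measurable_fst.
  transitivity (\int[g1]_a (\1_A a)%:E)%E; first by rewrite integral_indic// setIT.
  rewrite -(int1 (fun a => (\1_A a)%:E))//; last exact/measurable_EFinP/measurable_indic.
  transitivity (\int[M]_u (\1_(fst @^-1` A) u)%:E)%E; last by rewrite integral_indic// setIT.
  by rewrite MI//; exact/measurable_EFinP/measurable_indic.
have M2 A : measurable A -> g2 A = M (snd @^-1` A).
  move=> mA; have mA' : measurable (snd @^-1` A : set ((T * T) * (T * T))).
    by rewrite -[X in measurable X]setTI; exact: measurable_snd.
  transitivity (\int[g2]_a (\1_A a)%:E)%E; first by rewrite integral_indic// setIT.
  rewrite -(int2 (fun a => (\1_A a)%:E))//; last exact/measurable_EFinP/measurable_indic.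
  transitivity (\int[M]_u (\1_(snd @^-1` A) u)%:E)%E; last by rewrite integral_indic// setIT.
  by rewrite MI//; exact/measurable_EFinP/measurable_indic.
have mout : measurable_fun setT (fun u : (T * T) * (T * T) => (u.1.1, u.2.2)).
  apply: measurable_fun_pair.
    exact: (measurableT_comp measurable_fst measurable_fst).
  exact: (measurableT_comp measurable_snd measurable_snd).
have [g gE] := pushforward_probability M _ mout.
exists g; split.
  move=> A mA; have [cA _] := c1 A mA; have [_ cA'] := c2 A mA; rewrite !gE.
  by split; [rewrite -cA M1//|rewrite -cA' M2//]; exact: measurableX.
have q0 : 0 < q by rewrite (lt_le_trans ltr01).
have md1 : measurable_fun setT (fun u : (T * T) * (T * T) => dist u.1.1 u.1.2).
  exact: (measurableT_comp mdist measurable_fst).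
have md2 : measurable_fun setT (fun u : (T * T) * (T * T) => dist u.2.1 u.2.2).
  exact: (measurableT_comp mdist measurable_snd).
have norm_M (f : (T * T) * (T * T) -> R) : (forall u, 0 <= f u) ->
    Lnorm M q%:E (EFin \o f) = ((\int[M]_u (f u `^ q)%:E) `^ q^-1)%E.
  move=> f0; rewrite unlock; congr (_ `^ _)%E; apply: eq_integral => u _.
  by rewrite abse_EFin poweR_EFin ger0_norm.
have -> : wcost dist q%:E g1 = Lnorm M q%:E (EFin \o (fun u => dist u.1.1 u.1.2)).
  rewrite norm_M//=; congr (_ `^ _)%E.
  apply: (ge0_integral_image M g1 fst _ measurable_fst M1).
    by apply/measurable_EFinP; exact: (measurableT_comp (measurable_powR _) mdist).
  by move=> x; rewrite lee_fin powR_ge0.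
have -> : wcost dist q%:E g2 = Lnorm M q%:E (EFin \o (fun u => dist u.2.1 u.2.2)).
  rewrite norm_M//=; congr (_ `^ _)%E.
  apply: (ge0_integral_image M g2 snd _ measurable_snd M2).
    by apply/measurable_EFinP; exact: (measurableT_comp (measurable_powR _) mdist).
  by move=> x; rewrite lee_fin powR_ge0.
have -> : e%:E = Lnorm M q%:E (EFin \o cst e).
  rewrite norm_M; last by move=> u; exact: ltW.
  rewrite (_ : (\int[M]_u _)%E = (e `^ q)%:E) ?poweR_EFin -?powRrM; last first.
    by rewrite (integral_cst M measurableT (e `^ q)%:E) [X in (_ * X)%E]probability_setT mule1.
  rewrite divff ?gt_eqF//.
  by rewrite powRr1// ltW.
apply: (@le_trans _ _ (Lnorm M q%:E (EFin \o
    (fun u => dist u.1.1 u.1.2 + e + dist u.2.1 u.2.2)%R))); last first.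
  apply: (@le_trans _ _ (Lnorm M q%:E (EFin \o (fun u => dist u.1.1 u.1.2 + e)%R)
      + Lnorm M q%:E (EFin \o (fun u => dist u.2.1 u.2.2)))%E).
    apply: (@minkowski_EFin _ _ _ M (fun u => dist u.1.1 u.1.2 + e)%R) => //.
    exact: measurable_funD.
  by rewrite leeD2r//; exact: (@minkowski_EFin _ _ _ M _ (cst e)).
have s0 u : 0 <= dist u.1.1 u.1.2 + e + dist u.2.1 u.2.2.
  by rewrite !addr_ge0// ltW.
have ms : measurable_fun setT (fun u : (T * T) * (T * T) =>
    (dist u.1.1 u.1.2 + e + dist u.2.1 u.2.2) `^ q).
  apply: (measurableT_comp (measurable_powR _)).
  by apply: measurable_funD => //; exact: measurable_funD.
have mo : measurable_fun setT (fun u : (T * T) * (T * T) => dist u.1.1 u.2.2 `^ q).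
  apply: (measurableT_comp (measurable_powR _)).
  exact: (measurableT_comp mdist mout).
rewrite norm_M//=; apply: gt0_ler_poweR.
- by rewrite invr_ge0 ltW.
- by rewrite in_itv/= leey andbT; apply: integral_ge0 => u _; rewrite lee_fin powR_ge0.
- by rewrite in_itv/= leey andbT; apply: integral_ge0 => u _; rewrite lee_fin powR_ge0.
rewrite (ge0_integral_image M g (fun u => (u.1.1, u.2.2)))//; last 3 first.
- by move=> A mA; exact: gE.
- by apply/measurable_EFinP; exact: (measurableT_comp (measurable_powR _) mdist).
- by move=> z; rewrite lee_fin powR_ge0.
rewrite MI; first last.
- by move=> u; rewrite lee_fin powR_ge0.
- exact/measurable_EFinP.
rewrite MI; first last.
- by move=> u; rewrite lee_fin powR_ge0.
- exact/measurable_EFinP.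
apply: ge0_le_integral => //.
- by move=> u _; rewrite -EFinM lee_fin mulr_ge0// powR_ge0.
- by apply: emeasurable_funM; exact/measurable_EFinP.
- by apply: emeasurable_funM; exact/measurable_EFinP.
move=> u _ /=; rewrite -!EFinM lee_fin /weight.
(* Where the middle points lie in different cells the weight vanishes, and with it both
   integrands. *)
have [uu|] := eqVneq; last by rewrite !mulr0.
rewrite ler_wpM2r ?mulr_ge0//; apply: ge0_ler_powR; rewrite ?nnegrE//; first exact: ltW.
rewrite (le_trans (dist_triangle _ u.2.1 _))// lerD2r.
by rewrite (le_trans (dist_triangle _ u.1.2 _))// lerD2l phiE.
Qed.
End glue.

Lemma Wass_triangle (q : R) mu nu rho : 1 <= q ->
  (forall x y z, dist x z <= dist x y + dist y z) ->
  (forall e, 0 < e -> exists phi : T -> nat,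
     (forall n, measurable (phi @^-1` [set n])) /\
     forall x y, phi x = phi y -> dist x y <= e) ->
  (Wass dist q%:E mu rho <= Wass dist q%:E mu nu + Wass dist q%:E nu rho)%E.
Proof.
move=> q1 dD disc.
have [->|W1] := eqVneq (Wass dist q%:E mu nu) +oo%E.
  by rewrite addye ?leey// -ltNye (lt_le_trans _ (Wass_ge0 _ _ _)).
have [->|W2] := eqVneq (Wass dist q%:E nu rho) +oo%E.
  by rewrite addey ?leey// -ltNye (lt_le_trans _ (Wass_ge0 _ _ _)).
have W1f : Wass dist q%:E mu nu \is a fin_num.
  by rewrite ge0_fin_numE ?Wass_ge0// ltey.
have W2f : Wass dist q%:E nu rho \is a fin_num.
  by rewrite ge0_fin_numE ?Wass_ge0// ltey.
apply/lee_addgt0Pr => e e0.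
(* One third of the error goes to each coupling and one to the diameter of the cells. *)
have e30 : 0 < e / 3 by rewrite divr_gt0.
have [_ [g1 [c1 ->]] w1] := lb_ereal_inf_adherent e30 W1f.
have [_ [g2 [c2 ->]] w2] := lb_ereal_inf_adherent e30 W2f.
have [phi [mphi phiE]] := disc _ e30.
have [g [cg wg]] := glue_couplings dD q (e / 3) q1 e30 phi mphi phiE nu mu rho g1 g2 c1 c2.
apply: (@le_trans _ _ (wcost dist q%:E g)).
  by apply: ereal_inf_lbound; exists g.
apply: (le_trans wg).
rewrite -/(Wass dist q%:E mu nu) in w1; rewrite -/(Wass dist q%:E nu rho) in w2.
apply: (@le_trans _ _ (Wass dist q%:E mu nu + (e / 3)%:E + (e / 3)%:E +
    (Wass dist q%:E nu rho + (e / 3)%:E))%E).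
  by apply: leeD; [apply: leeD => //|]; exact: ltW.
rewrite -(fineK W1f) -(fineK W2f) -!EFinD lee_fin.
by move: (fine _) (fine _) => a b; lra.
Qed.

End wasserstein.

(** * Relative entropy *)

Section real_integrals.
Local Open Scope ereal_scope.
Context {d} {T : measurableType d} {R : realType}.
Variables (mu : {measure set T -> \bar R}) (D : set T) (mD : measurable D).
Implicit Types f g : T -> R.

Lemma integral_EFinD f g : measurable_fun setT f -> measurable_fun setT g ->
  (forall x, 0 <= f x)%R -> (forall x, 0 <= g x)%R ->
  \int[mu]_(x in D) (f x + g x)%:E =
  \int[mu]_(x in D) (f x)%:E + \int[mu]_(x in D) (g x)%:E.
Proof.
move=> mf mg f0 g0; under eq_integral do rewrite EFinD.
by rewrite ge0_integralD// => [x _||x _|]; rewrite ?lee_fin//;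
  exact/measurable_EFinP/measurable_funTS.
Qed.

Lemma integral_EFinZ (k : R) f : measurable_fun setT f ->
  (forall x, 0 <= f x)%R -> (0 <= k)%R ->
  \int[mu]_(x in D) (k * f x)%:E = k%:E * \int[mu]_(x in D) (f x)%:E.
Proof.
move=> mf f0 k0; under eq_integral do rewrite EFinM.
by rewrite ge0_integralZl_EFin// => [x _|]; rewrite ?lee_fin//;
  exact/measurable_EFinP/measurable_funTS.
Qed.

End real_integrals.

Lemma integral_probability_cst {d} {T : measurableType d} {R : realType}
  (P : probability T R) (k : R) : (\int[P]_x k%:E = k%:E)%E.
Proof.
by rewrite (integral_cst P measurableT k%:E) [X in (_ * X)%E]probability_setT mule1.
Qed.

Section entropy_function.
Context {R : realType}.
Implicit Types s t : R.

(** The graph of the convex function s ln s lies above its tangent at t; this is ln (1 + x) <= x at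
    x = t / s - 1. *)
Lemma xlnx_tangent s t : 0 <= s -> 0 < t -> s * ln t + s - t <= s * ln s.
Proof.
move=> s0 t0; have [->|sn0] := eqVneq s 0; first by rewrite !mul0r addr0 sub0r oppr_le0 ltW.
have {sn0}s0 : 0 < s by rewrite lt_neqAle eq_sym sn0.
have : ln (1 + (t / s - 1)) <= t / s - 1 by apply: le_ln1Dx; rewrite ltrBrDl subrr divr_gt0.
rewrite addrCA subrr addr0 ln_div ?posrE// => H.
have := ler_wpM2l (ltW s0) H; rewrite !mulrBr mulr1 mulrCA divff ?gt_eqF// mulr1.
by move: (s * ln t) (s * ln s) => a b; lra.
Qed.

Lemma xlnx_ge s : 0 <= s -> s <= s * ln s + 1.
Proof. by move=> s0; have := xlnx_tangent s 1 s0 ltr01; rewrite ln1 mulr0; lra. Qed.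

Lemma xlnx1_ge0 s : 0 <= s -> 0 <= s * ln s + 1.
Proof. by move=> s0; rewrite (le_trans s0)// xlnx_ge. Qed.

(** Convexity of s ln s with its defect kept: the extra term is t times the relative entropy
    integrand of v against the mixture w. Once v ln v cancels, the claim is the tangent inequality
    for u at w, multiplied by 1 - t. *)
Lemma xlnx_mix (t u v w : R) : 0 < t -> t < 1 -> 0 <= u -> 0 <= v ->
  w = (1 - t) * u + t * v ->
  w * ln w + 1 + t * (v * ln v + w - (v * ln w + v)) <=
  (1 - t) * (u * ln u + 1) + t * (v * ln v + 1).
Proof.
move=> t0 t1 u0 v0 wE; have t10 : 0 < 1 - t by rewrite subr_gt0.
have w0 : 0 <= w by rewrite wE addr_ge0// mulr_ge0// ltW.
have [we|wn0] := eqVneq w 0.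
  have : 0 <= (1 - t) * u by rewrite mulr_ge0// ltW.
  have : 0 <= t * v by rewrite mulr_ge0// ltW.
  move=> tv tu; have tu0 : (1 - t) * u = 0 by move: we; rewrite wE; lra.
  have tv0 : t * v = 0 by move: we; rewrite wE; lra.
  have -> : u = 0 by apply/eqP; move/eqP: tu0; rewrite mulf_eq0 (gt_eqF t10).
  have -> : v = 0 by apply/eqP; move/eqP: tv0; rewrite mulf_eq0 (gt_eqF t0).
  by rewrite we !mul0r; lra.
have wp : 0 < w by rewrite lt_neqAle eq_sym wn0.
have := ler_wpM2l (ltW t10) (xlnx_tangent u w u0 wp).
by move: (ln u) (ln v) (ln w) => a b e; rewrite wE => H; nra.
Qed.

End entropy_function.

Section relative_entropy.
Local Open Scope ereal_scope.
Context {d} {T : measurableType d} {R : realType}.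
Implicit Types (th mu : probability T R) (f : T -> R).

Definition is_density th mu f :=
  [/\ measurable_fun setT f, (forall x, (0 <= f x)%R) &
      forall A, measurable A -> th A = \int[mu]_(x in A) (f x)%:E].

(* Shifting the integrand by 1 makes it nonnegative, so that all integrals are
   defined unconditionally. *)
Definition ent mu f : \bar R := \int[mu]_x (f x * ln (f x) + 1)%:E.

Lemma measurable_xlnx f : measurable_fun setT f ->
  measurable_fun setT (fun x => f x * ln (f x))%R.
Proof.
by move=> mf; apply: measurable_funM => //; exact: (measurableT_comp (@measurable_ln R)).
Qed.

Lemma measurable_xlnx1 f : measurable_fun setT f ->
  measurable_fun setT (fun x => f x * ln (f x) + 1)%R.
Proof. by move=> mf; apply: measurable_funD => //; exact: measurable_xlnx. Qed.

Lemma density_integral1 th mu f : is_density th mu f -> \int[mu]_x (f x)%:E = 1.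
Proof. by move=> [_ _ <-]//; exact: probability_setT. Qed.

(** The integrand is at least -1, so its negative part has a finite integral and can be moved across
    the equation even when the positive part is not integrable. *)
Lemma integral_xlnx mu f : measurable_fun setT f -> (forall x, (0 <= f x)%R) ->
  \int[mu]_x (f x * ln (f x))%:E = ent mu f - 1.
Proof.
move=> mf f0; set u := fun x => (f x * ln (f x))%R.
have mu_ : measurable_fun setT u by exact: measurable_xlnx.
have u1 x : (0 <= u x + 1)%R by rewrite xlnx1_ge0.
pose up x := Num.max (u x) 0%R; pose un x := Num.max (- u x)%R 0%R.
have mup : measurable_fun setT up by exact: measurable_maxr.
have mun : measurable_fun setT un.
  by apply: measurable_maxr => //; exact: measurableT_comp.
have un0 x : (0 <= un x)%R by rewrite le_max lexx orbT.
have up0 x : (0 <= up x)%R by rewrite le_max lexx orbT.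
have un1 x : (un x <= 1)%R by rewrite ge_max ler01 andbT; have := u1 x; lra.
rewrite integralE.
have -> : \int[mu]_x (EFin \o u)^\+ x = \int[mu]_x (up x)%:E.
  by apply: eq_integral => x _; rewrite funeposE /= EFin_max.
have -> : \int[mu]_x (EFin \o u)^\- x = \int[mu]_x (un x)%:E.
  by apply: eq_integral => x _; rewrite funenegE /= EFin_max EFinN.
have n1 : \int[mu]_x (un x)%:E <= 1.
  rewrite -(integral_probability_cst mu 1).
  apply: ge0_le_integral => //; last by move=> x _; rewrite lee_fin.
  - by move=> x _; rewrite lee_fin.
  - exact/measurable_EFinP.
have nf : \int[mu]_x (un x)%:E \is a fin_num.
  rewrite ge0_fin_numE ?(le_lt_trans n1) ?ltry//.
  by apply: integral_ge0 => x _; rewrite lee_fin.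
have H : ent mu f + \int[mu]_x (un x)%:E = \int[mu]_x (up x)%:E + 1.
  rewrite -(integral_probability_cst mu 1) -!integral_EFinD//; last first.
    exact: measurable_xlnx1.
  apply: eq_integral => x _; congr EFin; rewrite -/(u x) /up /un.
  by rewrite !maxEle; case: ifPn => ?; case: ifPn => ?; lra.
have -> : \int[mu]_x (up x)%:E = ent mu f - 1 + \int[mu]_x (un x)%:E.
  by rewrite addeAC H addeK.
by rewrite addeK.
Qed.

Lemma KL_density th mu f : is_density th mu f -> KL th mu = ent mu f - 1.
Proof.
move=> [mf f0 fE]; rewrite -integral_xlnx//; apply/eqP; rewrite eq_le; apply/andP; split.
  by apply: ereal_inf_lbound; exists f.
apply/ereal_infP => _ [g [mg g0 gE ->]]; rewrite le_eqVlt; apply/orP; left; apply/eqP.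
apply: ae_eq_integral => //.
- exact/measurable_EFinP/measurable_xlnx.
- exact/measurable_EFinP/measurable_xlnx.
have := density_ae_unique th mu f mf f0 fE g mg gE.
by apply: filterS => x /= -> _.
Qed.

Lemma ent_ge1 th mu f : is_density th mu f -> 1 <= ent mu f.
Proof.
move=> dens; have [mf f0 fE] := dens; rewrite -(density_integral1 _ _ _ dens).
apply: ge0_le_integral => //.
- by move=> x _; rewrite lee_fin.
- exact/measurable_EFinP.
- exact/measurable_EFinP/measurable_xlnx1.
- by move=> x _; rewrite lee_fin xlnx_ge.
Qed.

Lemma exists_KL_density th mu : KL th mu < +oo -> exists f, is_density th mu f.
Proof.
move=> KLoo; apply: contrapT => nf; move: KLoo; rewrite /KL (_ : [set e | _] = set0).
  by rewrite ereal_inf0.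
by apply/seteqP; split => // e [f [mf f0 fE _]]; apply: nf; exists f.
Qed.

Lemma KL_ge0 th mu : 0 <= KL th mu.
Proof.
have [KLoo|] := ltP (KL th mu) +oo; last by apply: le_trans.
have [f fd] := exists_KL_density _ _ KLoo.
by rewrite (KL_density _ _ _ fd) sube_ge0// (ent_ge1 _ _ _ fd).
Qed.

Lemma KL_self mu : KL mu mu = 0.
Proof.
have dens : is_density mu mu (fun=> 1%R).
  by split => // A mA; rewrite (integral_cst mu mA 1) mul1e.
by rewrite (KL_density _ _ _ dens) /ent ln1 mulr0 add0r integral_probability_cst subee.
Qed.

End relative_entropy.

(** * Data processing inequality *)

Section data_processing.
Local Open Scope ereal_scope.
Context {d0 d1 d2} {S : measurableType d0} {T1 : measurableType d1}
  {T2 : measurableType d2} {R : realType}.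

(** The right-hand side is the relative entropy of [G] with respect to [Gam]. With h the density of
    [pi2], integrate the tangent inequality f ln f >= f ln h + f - h, where f is taken at x(s) and h
    at y(s): the term f ln h becomes the integral of h ln h against [P2], and f and h both integrate
    to 1. *)
Lemma KL_data_processing (Gam G : probability S R) (x : S -> T1) (y : S -> T2)
    (P1 : probability T1 R) (P2 pi2 : probability T2 R) (f : T1 -> R) :
  measurable_fun setT x -> measurable_fun setT y ->
  (forall A, measurable A -> P1 A = Gam (x @^-1` A)) ->
  (forall A, measurable A -> P2 A = Gam (y @^-1` A)) ->
  (forall A, measurable A -> pi2 A = G (y @^-1` A)) ->
  measurable_fun setT f -> (forall t, (0 <= f t)%R) ->
  (forall A, measurable A -> G A = \int[Gam]_(s in A) (f (x s))%:E) ->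
  KL pi2 P2 <= ent P1 f - 1.
Proof.
move=> mx my P1E P2E piE mf f0 GE.
have mfx : measurable_fun setT (fun s => f (x s)) by exact: (measurableT_comp mf mx).
have [h hd] : exists h, is_density pi2 P2 h.
  apply: exists_density => A mA A0.
  have mA' : measurable (y @^-1` A) by rewrite -[X in measurable X]setTI; exact: my.
  rewrite [LHS]piE// GE//; apply: null_set_integral => //.
    exact/measurable_EFinP/measurable_funTS.
  by rewrite -[LHS]P2E.
have [mh h0 hE] := hd.
have mhy : measurable_fun setT (fun s => h (y s)) by exact: (measurableT_comp mh my).
rewrite (KL_density _ _ _ hd) leeD2r//.
(* Only nonnegative integrands can be transported between the measures, so ln is split into its two
   parts. The negative part contributes a finite number [n], which cancels at the end. *)
pose lp (t : R) : R := Num.max (ln t) 0%R; pose ln_ (t : R) : R := Num.max (- ln t)%R 0%R.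
have mlp : measurable_fun setT lp by apply: measurable_maxr => //; exact: measurable_ln.
have mln : measurable_fun setT ln_.
  by apply: measurable_maxr => //; exact: (measurableT_comp _ (@measurable_ln R)).
have lp0 t : (0 <= lp t)%R by rewrite le_max lexx orbT.
have ln0 t : (0 <= ln_ t)%R by rewrite le_max lexx orbT.
have lE t : (ln t = lp t - ln_ t)%R.
  by rewrite /lp /ln_ !maxEle; case: ifPn => ?; case: ifPn => ?; lra.
have transport (u : R -> R) : measurable_fun setT u -> (forall t, 0 <= u t)%R ->
    \int[Gam]_s (f (x s) * u (h (y s)))%:E = \int[P2]_t (h t * u (h t))%:E.
  move=> mu u0.
  have muh : measurable_fun setT (fun t => (u (h t))%:E).
    by apply/measurable_EFinP; exact: (measurableT_comp mu mh).
  have muhy : measurable_fun setT (fun s => (u (h (y s)))%:E).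
    by apply/measurable_EFinP; exact: (measurableT_comp mu mhy).
  have uh0 t : 0 <= (u (h t))%:E by rewrite lee_fin.
  transitivity (\int[G]_s (u (h (y s)))%:E).
    rewrite (ge0_integral_density G Gam (fun s => f (x s)) mfx (fun s => f0 (x s)) GE)//.
    by apply: eq_integral => s _; rewrite -EFinM mulrC.
  transitivity (\int[pi2]_t (u (h t))%:E).
    by apply/esym; apply: (ge0_integral_image G pi2 y (fun t => (u (h t))%:E) my piE).
  rewrite (ge0_integral_density pi2 P2 h mh h0 hE)//.
  by apply: eq_integral => s _; rewrite -EFinM mulrC.
have oneG : \int[Gam]_s (f (x s))%:E = 1.
  by rewrite -GE//; exact: probability_setT.
have oneh : \int[Gam]_s (h (y s))%:E = 1.
  rewrite -(density_integral1 _ _ _ hd); apply/esym.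
  by apply: (ge0_integral_image Gam P2 y (fun t => (h t)%:E) my P2E) => //; exact/measurable_EFinP.
have entE : ent P1 f = \int[Gam]_s (f (x s) * ln (f (x s)) + 1)%:E.
  apply: (ge0_integral_image Gam P1 x _ mx P1E).
  - exact/measurable_EFinP/measurable_xlnx1.
  - by move=> t; rewrite lee_fin xlnx1_ge0.
pose n := \int[P2]_t (h t * ln_ (h t))%:E.
have mhn : measurable_fun setT (fun t => h t * ln_ (h t))%R.
  by apply: measurable_funM => //; exact: (measurableT_comp mln mh).
have mhp : measurable_fun setT (fun t => h t * lp (h t))%R.
  by apply: measurable_funM => //; exact: (measurableT_comp mlp mh).
have one2 : \int[P2]_t (cst 1%R t)%:E = 1.
  exact: integral_probability_cst.
have one0 : \int[Gam]_t (cst 1%R t)%:E = 1.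
  exact: integral_probability_cst.
have nf : n \is a fin_num.
  rewrite ge0_fin_numE; last by apply: integral_ge0 => t _; rewrite lee_fin mulr_ge0.
  rewrite (@le_lt_trans _ _ 1) ?ltry// -one2; apply: ge0_le_integral => //.
  - by move=> t _; rewrite lee_fin mulr_ge0.
  - exact/measurable_EFinP.
  - exact/measurable_EFinP.
  - move=> t _; rewrite lee_fin /= /ln_ maxr_pMr// mulr0 ge_max ler01 andbT mulrN.
    by have := xlnx1_ge0 _ (h0 t); lra.
have entH : ent P2 h + n = \int[P2]_t (h t * lp (h t))%:E + 1.
  have hn0 t : (0 <= h t * ln_ (h t))%R by rewrite mulr_ge0.
  have hp0 t : (0 <= h t * lp (h t))%R by rewrite mulr_ge0.
  have hl0 t : (0 <= h t * ln (h t) + 1)%R by rewrite xlnx1_ge0.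
  have mhl := measurable_xlnx1 _ mh.
  rewrite -one2 -!integral_EFinD//.
  by apply: eq_integral => t _; congr EFin; rewrite lE /cst; ring.
have mlphy : measurable_fun setT (fun s => f (x s) * lp (h (y s)))%R.
  by apply: measurable_funM => //; exact: (measurableT_comp mlp mhy).
have mlnhy : measurable_fun setT (fun s => f (x s) * ln_ (h (y s)))%R.
  by apply: measurable_funM => //; exact: (measurableT_comp mln mhy).
have flp0 s : (0 <= f (x s) * lp (h (y s)))%R by rewrite mulr_ge0.
have fln0 s : (0 <= f (x s) * ln_ (h (y s)))%R by rewrite mulr_ge0.
have mxl := measurable_xlnx1 _ mfx.
have xl0 s : (0 <= f (x s) * ln (f (x s)) + 1)%R by rewrite xlnx1_ge0.
(* After adding [n] and 1 both sides are integrals of nonnegative functions; the 1 is the total mass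
   of f on the left and of h on the right. *)
suff : ent P2 h + n + 1 <= ent P1 f + n + 1 by rewrite leeD2rE// leeD2rE.
have s1 s : (0 <= f (x s) * lp (h (y s)) + f (x s))%R by rewrite addr_ge0.
have s2 s : (0 <= f (x s) * ln (f (x s)) + 1 + f (x s) * ln_ (h (y s)))%R.
  by rewrite addr_ge0.
have ms1 : measurable_fun setT (fun s => f (x s) * lp (h (y s)) + f (x s))%R.
  exact: measurable_funD.
have ms2 : measurable_fun setT (fun s => f (x s) * ln (f (x s)) + 1 + f (x s) * ln_ (h (y s)))%R.
  exact: measurable_funD.
have -> : ent P2 h + n + 1 =
    \int[Gam]_s (f (x s) * lp (h (y s)) + f (x s) + cst 1%R s)%:E.
  by rewrite integral_EFinD// integral_EFinD// transport// oneG one0 entH.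
have -> : ent P1 f + n + 1 =
    \int[Gam]_s (f (x s) * ln (f (x s)) + 1 + f (x s) * ln_ (h (y s)) + h (y s))%:E.
  by rewrite integral_EFinD// integral_EFinD// transport// oneh entE.
(* The tangent inequality needs h > 0. The set where h vanishes is null for [pi2], so f vanishes
   almost everywhere on its preimage. *)
have mB : measurable [set s | h (y s) = 0%R].
  by rewrite -[X in measurable X]setTI; exact: (mhy measurableT _ (measurable_set1 0%R)).
have zero : \int[Gam]_(s in [set s | h (y s) = 0%R]) `|(f (x s))%:E| = 0.
  rewrite (eq_integral (fun s => (f (x s))%:E)); last first.
    by move=> s _; rewrite gee0_abs// lee_fin.
  rewrite -GE//.
  have mh0 : measurable [set t | h t = 0%R].
    by rewrite -[X in measurable X]setTI; exact: (mh measurableT _ (measurable_set1 0%R)).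
  transitivity (pi2 [set t | h t = 0%R]); first by apply/esym; exact: piE.
  rewrite hE// (eq_integral (cst 0)); first by rewrite integral0.
  by move=> t /set_mem/= ->.
have /(ae_eq_integral_abs _ mB) aez := zero.
have {}aez := aez (measurable_funTS (proj2 (measurable_EFinP _ _) mfx)).
apply: ae_ge0_le_integral => //.
- by move=> s _; rewrite lee_fin addr_ge0// ler01.
- by apply/measurable_EFinP; exact: measurable_funD.
- by move=> s _; rewrite lee_fin addr_ge0.
- by apply/measurable_EFinP; exact: measurable_funD.
apply: filterS aez => s /= fs _; rewrite lee_fin.
have [hs0|hsn0] := eqVneq (h (y s)) 0%R.
  by have [->] := fs hs0; rewrite !mul0r !add0r hs0 !addr0 lexx.
have hsp : (0 < h (y s))%R by rewrite lt_neqAle eq_sym hsn0 h0.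
have := xlnx_tangent _ _ (f0 (x s)) hsp; rewrite lE.
rewrite /cst; move: (f (x s)) (h (y s)) (ln_ _) (lp _) (ln _) => a b e g k; lra.
Qed.

End data_processing.

(** * The Pythagorean inequality *)

Section pythagoras.
Local Open Scope ereal_scope.
Context {d} {T : measurableType d} {R : realType}.

(* The added term u - v, which integrates to 0 when u and v are probability
   densities, makes the integrand of the relative entropy nonnegative. *)
Definition kl_integrand (u v : R) : R := (v * ln v + u - (v * ln u + v))%R.

Lemma kl_integrand_ge0 (u v : R) : (0 <= v)%R -> (0 <= u)%R ->
  (u = 0 -> v = 0)%R -> (0 <= kl_integrand u v)%R.
Proof.
move=> v0 u0 uv; rewrite /kl_integrand.
have [u00|un0] := eqVneq u 0%R; first by rewrite (uv u00) u00 !mul0r; lra.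
have up : (0 < u)%R by rewrite lt_neqAle eq_sym un0.
by have := xlnx_tangent v u v0 up; lra.
Qed.

Variables (P ps pi : probability T R) (gs g c : T -> R).
Hypotheses (dps : is_density ps P gs) (dpi : is_density pi P g).
Hypotheses (mc : measurable_fun setT c) (c0 : forall x, (0 <= c x)%R).
Hypotheses (cs : \int[ps]_x (c x)%:E < +oo) (ci : \int[pi]_x (c x)%:E < +oo).
Hypotheses (es : ent P gs < +oo) (ei : ent P g < +oo).
Hypothesis opt : forall (t : R) (rho : probability T R), (0 < t)%R -> (t < 1)%R ->
  (forall A, measurable A -> rho A = (1 - t)%:E * ps A + t%:E * pi A) ->
  \int[ps]_x (c x)%:E + KL ps P <= \int[rho]_x (c x)%:E + KL rho P.

(** The excess of the objective at [pi] over its value at [ps]; the shifts by 1 inside [ent]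
    cancel. *)
Let gap : R := (fine (\int[pi]_x (c x)%:E) + fine (ent P g)
             - (fine (\int[ps]_x (c x)%:E) + fine (ent P gs)))%R.

Let mgs : measurable_fun setT gs. Proof. by case: dps. Qed.
Let mg : measurable_fun setT g. Proof. by case: dpi. Qed.
Let gs0 x : (0 <= gs x)%R. Proof. by case: dps. Qed.
Let g0 x : (0 <= g x)%R. Proof. by case: dpi. Qed.

Let mix (t : R) x : R := ((1 - t) * gs x + t * g x)%R.

Let mmix t : measurable_fun setT (mix t).
Proof. by apply: measurable_funD; apply: measurable_funM. Qed.

Let mix_ge0 t x : (0 < t)%R -> (t < 1)%R -> (0 <= mix t x)%R.
Proof. by move=> t0 t1; rewrite addr_ge0// mulr_ge0// ?subr_ge0 ltW. Qed.

Let mkl u v : measurable_fun setT u -> measurable_fun setT v ->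
  measurable_fun setT (fun x : T => kl_integrand (u x) (v x)).
Proof.
move=> mu mv; apply: measurable_funB.
  by apply: measurable_funD => //; exact: measurable_xlnx.
apply: measurable_funD => //; apply: measurable_funM => //.
exact: (measurableT_comp (@measurable_ln R)).
Qed.

Let kl_mix_ge0 t x : (0 < t)%R -> (t < 1)%R -> (0 <= kl_integrand (mix t x) (g x))%R.
Proof.
move=> t0 t1; apply: kl_integrand_ge0 => //; first exact: mix_ge0.
move=> mix0.
have : (0 <= (1 - t) * gs x)%R by rewrite mulr_ge0// subr_ge0 ltW.
have : (0 <= t * g x)%R by rewrite mulr_ge0// ltW.
move=> tg tgs; have : (t * g x = 0)%R by move: mix0; rewrite /mix; lra.
by move=> /eqP; rewrite mulf_eq0 (gt_eqF t0)/= => /eqP.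
Qed.

(** Optimality of [ps] against the mixture, whose cost is affine in t and whose entropy is bounded
    by integrating [xlnx_mix], gives the inequality multiplied by t; then divide by t. *)
Let kl_mix_le t : (0 < t)%R -> (t < 1)%R ->
  \int[P]_x (kl_integrand (mix t x) (g x))%:E <= gap%:E.
Proof.
move=> t0 t1; have t10 : (0 <= 1 - t)%R by rewrite subr_ge0 ltW.
have tge0 := ltW t0.
have intmix (u : T -> R) : measurable_fun setT u -> (forall x, 0 <= u x)%R ->
    \int[P]_x (u x * mix t x)%:E =
    (1 - t)%:E * \int[P]_x (u x * gs x)%:E + t%:E * \int[P]_x (u x * g x)%:E.
  move=> mu u0.
  have m1 : measurable_fun setT (fun x => u x * gs x)%R by exact: measurable_funM.
  have m2 : measurable_fun setT (fun x => u x * g x)%R by exact: measurable_funM.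
  have p1 x : (0 <= u x * gs x)%R by exact: mulr_ge0.
  have p2 x : (0 <= u x * g x)%R by exact: mulr_ge0.
  have m3 k : measurable_fun setT (fun x => k * (u x * gs x))%R by exact: measurable_funM.
  have m4 k : measurable_fun setT (fun x => k * (u x * g x))%R by exact: measurable_funM.
  have p3 x : (0 <= (1 - t) * (u x * gs x))%R by exact: mulr_ge0.
  have p4 x : (0 <= t * (u x * g x))%R by exact: mulr_ge0.
  rewrite -integral_EFinZ// -integral_EFinZ// -integral_EFinD//.
  by apply: eq_integral => x _; congr EFin; rewrite /mix; ring.
have mixA A : measurable A -> \int[P]_(x in A) (mix t x)%:E = (1 - t)%:E * ps A + t%:E * pi A.
  move=> mA; have [_ _ ->//] := dps; have [_ _ ->//] := dpi.
  have m3 k : measurable_fun setT (fun x => k * gs x)%R by exact: measurable_funM.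
  have m4 k : measurable_fun setT (fun x => k * g x)%R by exact: measurable_funM.
  have p3 x : (0 <= (1 - t) * gs x)%R by exact: mulr_ge0.
  have p4 x : (0 <= t * g x)%R by exact: mulr_ge0.
  by rewrite -integral_EFinZ// -integral_EFinZ// -integral_EFinD.
have [rho rhoE] : exists rho : probability T R,
    forall A, rho A = \int[P]_(x in A) (mix t x)%:E.
  apply: density_probability => // [x|]; first exact: mix_ge0.
  rewrite mixA// [X in _ * X + _](probability_setT ps) [X in _ + _ * X](probability_setT pi).
  by rewrite !mule1 -EFinD subrK.
have drho : is_density rho P (mix t) by split => // x; exact: mix_ge0.
have := opt t rho t0 t1 (fun A mA => etrans (rhoE A) (mixA A mA)).
have mcE : measurable_fun setT (fun x => (c x)%:E) by exact/measurable_EFinP.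
have c0E x : 0 <= (c x)%:E by rewrite lee_fin.
have cE (rho' : probability T R) h : is_density rho' P h ->
    \int[rho']_x (c x)%:E = \int[P]_x (c x * h x)%:E.
  by move=> [mh h0 hE]; rewrite (ge0_integral_density rho' P h mh h0 hE).
rewrite (cE _ _ drho) intmix// -(cE _ _ dps) -(cE _ _ dpi).
rewrite (KL_density _ _ _ dps) (KL_density _ _ _ drho).
have csf : \int[ps]_x (c x)%:E \is a fin_num by rewrite ge0_fin_numE// integral_ge0.
have cif : \int[pi]_x (c x)%:E \is a fin_num by rewrite ge0_fin_numE// integral_ge0.
have esf : ent P gs \is a fin_num by rewrite ge0_fin_numE// (le_trans _ (ent_ge1 _ _ _ dps)).
have eif : ent P g \is a fin_num by rewrite ge0_fin_numE// (le_trans _ (ent_ge1 _ _ _ dpi)).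
have k0 x := kl_mix_ge0 t x t0 t1.
have key : ent P (mix t) + t%:E * \int[P]_x (kl_integrand (mix t x) (g x))%:E <=
    (1 - t)%:E * ent P gs + t%:E * ent P g.
  have n1 x : (0 <= mix t x * ln (mix t x) + 1)%R by rewrite xlnx1_ge0// mix_ge0.
  have n2 x : (0 <= gs x * ln (gs x) + 1)%R by rewrite xlnx1_ge0.
  have n3 x : (0 <= g x * ln (g x) + 1)%R by rewrite xlnx1_ge0.
  have o1 := measurable_xlnx1 _ (mmix t).
  have o2 := measurable_xlnx1 _ mgs.
  have o3 := measurable_xlnx1 _ mg.
  have o4 := mkl _ _ (mmix t) mg.
  have n4 x : (0 <= t * kl_integrand (mix t x) (g x))%R by rewrite mulr_ge0.
  have n5 x : (0 <= (1 - t) * (gs x * ln (gs x) + 1))%R by rewrite mulr_ge0.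
  have n6 x : (0 <= t * (g x * ln (g x) + 1))%R by rewrite mulr_ge0.
  have o5 : measurable_fun setT (fun x => t * kl_integrand (mix t x) (g x))%R.
    exact: measurable_funM.
  have o6 : measurable_fun setT (fun x => (1 - t) * (gs x * ln (gs x) + 1))%R.
    exact: measurable_funM.
  have o7 : measurable_fun setT (fun x => t * (g x * ln (g x) + 1))%R.
    exact: measurable_funM.
  rewrite -!integral_EFinZ// -!integral_EFinD//.
  apply: ge0_le_integral => //.
  - by move=> x _; rewrite lee_fin addr_ge0.
  - by apply/measurable_EFinP; exact: measurable_funD.
  - by apply/measurable_EFinP; exact: measurable_funD.
  - by move=> x _; rewrite lee_fin; exact: xlnx_mix.
have emf : ent P (mix t) \is a fin_num.
  rewrite ge0_fin_numE; last by rewrite (le_trans _ (ent_ge1 _ _ _ drho)).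
  apply: (@le_lt_trans _ _ ((1 - t)%:E * ent P gs + t%:E * ent P g)).
    apply: le_trans key; rewrite leeDl// mule_ge0 ?lee_fin// integral_ge0// => x _.
    by rewrite lee_fin.
  by rewrite -(fineK esf) -(fineK eif) -!EFinM -EFinD ltry.
(* An infinite integral would make the finite right-hand side of [key] infinite; finiteness allows
   the computation to be done over the reals. *)
have klf : \int[P]_x (kl_integrand (mix t x) (g x))%:E \is a fin_num.
  rewrite ge0_fin_numE; last by apply: integral_ge0 => x _; rewrite lee_fin.
  rewrite ltNge leye_eq; apply/negP => /eqP kloo; move: key.
  rewrite kloo gt0_muley ?lte_fin// addey ?leye_eq.
    by rewrite -(fineK esf) -(fineK eif) -!EFinM -EFinD.
  by move: emf; rewrite fin_numE => /andP[].
move: key; rewrite /gap -(fineK csf) -(fineK cif) -(fineK esf) -(fineK eif).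
rewrite -(fineK emf) -(fineK klf) -!EFinM -!EFinD !lee_fin /=.
move: (fine _) (fine _) (fine _) (fine _) (fine _) (fine _) => A B C D E F H1 H2.
rewrite -(ler_pM2l t0); lra.
Qed.

Let null_set : measurable [set x | gs x = 0%R].
Proof. by rewrite -[X in measurable X]setTI; exact: (mgs measurableT _ (measurable_set1 0%R)). Qed.

(* On {gs = 0} the mixture is t g, so the integrand is at least g (- ln t - 1);
   letting t tend to 0 forces g to vanish there. *)
Let vanishing : \int[P]_(x in [set x | gs x = 0%R]) (g x)%:E = 0.
Proof.
set I := \int[P]_(x in _) _.
have I0 : 0 <= I by apply: integral_ge0 => x _; rewrite lee_fin.
have bound (k : nat) : k%:R%:E * I <= gap%:E.
  (* With - ln t = k + 1 the integrand on {gs = 0} is k g + t g, hence at least k g. *)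
  pose t : R := expR (- k.+1%:R).
  have t0 : (0 < t)%R by exact: expR_gt0.
  have t1 : (t < 1)%R by rewrite -expR0 ltr_expR oppr_lt0 ltr0n.
  apply: le_trans (kl_mix_le t t0 t1).
  apply: (@le_trans _ _ (\int[P]_(x in [set x | gs x = 0%R])
      (kl_integrand (mix t x) (g x))%:E)); last first.
    apply: ge0_subset_integral => //.
    - exact/measurable_EFinP/mkl.
    - by move=> x _; rewrite lee_fin kl_mix_ge0.
  rewrite /I -integral_EFinZ//; apply: ge0_le_integral => //.
  - by move=> x _; rewrite lee_fin mulr_ge0.
  - by apply/measurable_EFinP/measurable_funTS; exact: measurable_funM.
  - by apply/measurable_EFinP/measurable_funTS; exact: mkl.
  move=> x /= gsx; rewrite lee_fin /kl_integrand /mix gsx mulr0 add0r.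
  have [gx0|gxn0] := eqVneq (g x) 0%R; first by rewrite gx0 ?(mul0r, mulr0); lra.
  have gxp : (0 < g x)%R by rewrite lt_neqAle eq_sym gxn0 g0.
  rewrite lnM ?posrE// expRK -natr1.
  have : (0 <= t * g x)%R by rewrite mulr_ge0// ltW.
  by move: (ln _) (t * _)%R (k%:R : R) => a b e; nra.
have If : I \is a fin_num.
  have := bound 1%N; rewrite mul1e ge0_fin_numE// => /le_lt_trans; apply; exact: ltry.
rewrite -(fineK If); congr EFin; apply/eqP; rewrite eq_le fine_ge0// andbT.
rewrite leNgt; apply/negP => Ip.
have gap0 : (0 <= gap)%R by have := bound 0%N; rewrite mul0e lee_fin.
have := bound (Num.bound (gap / fine I)); rewrite -(fineK If) -EFinM lee_fin leNgt => /negP; apply.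
by rewrite -ltr_pdivrMr//; apply: archi_boundP; rewrite divr_ge0// ltW.
Qed.

Let support := ~` [set x | gs x = 0%R].

Let msupport : measurable support. Proof. exact: measurableC. Qed.

(** Fatou's lemma as t tends to 0: where gs > 0, continuity of ln makes the integrands converge. *)
Let kl_support_le : \int[P]_(x in support) (kl_integrand (gs x) (g x))%:E <= gap%:E.
Proof.
(* Starting at 1/2 keeps every t strictly below 1. *)
pose t n : R := ((n.+2%:R)^-1)%R.
have t0 n : (0 < t n)%R by rewrite invr_gt0 ltr0n.
have t1 n : (t n < 1)%R by rewrite invf_lt1 ?ltr0n// ltr1n.
have mf n : measurable_fun support (fun x => (kl_integrand (mix (t n) x) (g x))%:E).
  by apply/measurable_EFinP/measurable_funTS; exact: mkl.
have f0 n x : support x -> 0 <= (kl_integrand (mix (t n) x) (g x))%:E.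
  by move=> _; rewrite lee_fin kl_mix_ge0.
have tcvg : t n @[n --> \oo] --> (0 : R)%R.
  by have := @cvg_harmonic R; rewrite -cvg_shiftS.
have := fatou P msupport mf f0.
rewrite (eq_integral (fun x => (kl_integrand (gs x) (g x))%:E)); last first.
  move=> x /set_mem/= gsx.
  have gsp : (0 < gs x)%R by rewrite lt_neqAle eq_sym gs0 andbT; apply/eqP.
  have mixc : mix (t n) x @[n --> \oo] --> gs x.
    have H1 : ((1 - t n) * gs x)%R @[n --> \oo] --> ((1 - 0) * gs x)%R.
      by apply: cvgM; [apply: cvgB; [exact: cvg_cst|exact: tcvg]|exact: cvg_cst].
    have H2 : (t n * g x)%R @[n --> \oo] --> (0 * g x)%R.
      by apply: cvgM; [exact: tcvg|exact: cvg_cst].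
    rewrite subr0 mul1r in H1; rewrite mul0r in H2.
    by have H := cvgD H1 H2; rewrite addr0 in H; exact: H.
  suff /cvg_limn_einf_sup[-> _] : (kl_integrand (mix (t n) x) (g x))%:E @[n --> \oo] -->
      (kl_integrand (gs x) (g x))%:E by [].
  apply: cvg_EFin; first exact: nearW.
  apply: cvgB; first by apply: cvgD => //; exact: cvg_cst.
  apply: cvgD; last exact: cvg_cst.
  apply: cvgM; first exact: cvg_cst.
  by apply: continuous_cvg => //; exact: continuous_ln.
move=> /le_trans; apply; rewrite limn_einf_lim; apply: lime_le; first exact: is_cvg_einfs.
apply: nearW => n.
apply: (@le_trans _ _ (\int[P]_(x in support) (kl_integrand (mix (t n) x) (g x))%:E)).
  by apply: ereal_inf_lbound; exists n => /=.
apply: le_trans (kl_mix_le _ (t0 n) (t1 n)); apply: ge0_subset_integral => //.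
- exact/measurable_EFinP/mkl.
- by move=> x _; rewrite lee_fin kl_mix_ge0.
Qed.

(** By [vanishing], the quotient g / gs is a density of [pi] with respect to [ps], and its relative
    entropy is at most the integral of [kl_integrand] over the support, which [kl_support_le] bounds
    by [gap]. *)
Lemma KL_pythagoras :
  \int[ps]_x (c x)%:E + KL ps P + KL pi ps <= \int[pi]_x (c x)%:E + KL pi P.
Proof.
pose r x : R := (g x / gs x)%R.
have mr : measurable_fun setT r.
  apply: (eq_measurable_fun (fun x => g x * gs x `^ (-1))%R).
    by move=> x _; rewrite powR_inv1.
  by apply: measurable_funM => //; exact: (measurableT_comp (measurable_powR _) mgs).
have r0 x : (0 <= r x)%R by rewrite divr_ge0.
have [_ _ psE] := dps; have [_ _ piE] := dpi.
have ae0 : {ae P, forall x, gs x = 0%R -> g x = 0%R}.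
  have H : \int[P]_(x in [set x | gs x = 0%R]) `|(g x)%:E| = 0.
    rewrite -[RHS]vanishing; apply: eq_integral => x _.
    by rewrite gee0_abs// lee_fin.
  have /(ae_eq_integral_abs _ null_set) aez := H.
  have {}aez := aez (measurable_funTS (proj2 (measurable_EFinP _ _) mg)).
  by apply: filterS aez => x /= gx gsx; have [] := gx gsx.
have dr : is_density pi ps r.
  split => // A mA; rewrite piE// [RHS]integral_mkcond.
  have mrA : measurable_fun setT ((fun x => (r x)%:E) \_ A).
    by apply/(measurable_restrictT _ mA)/measurable_EFinP/measurable_funTS.
  rewrite (ge0_integral_density ps P gs mgs gs0 psE _ mrA); last first.
    by move=> x; rewrite patchE; case: ifPn => // _; rewrite lee_fin.
  rewrite integral_mkcond; apply: ae_eq_integral => //.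
  - by apply/(measurable_restrictT _ mA)/measurable_EFinP/measurable_funTS.
  - by apply: emeasurable_funM => //; exact/measurable_EFinP.
  apply: filterS ae0 => x gx _; rewrite !patchE; case: ifPn => _; last by rewrite mul0e.
  rewrite -EFinM /r; congr EFin; have [gsx|gsx] := eqVneq (gs x) 0%R.
    by rewrite (gx gsx) !mul0r.
  by rewrite divfK.
have KLle : KL pi ps <= gap%:E.
  rewrite (KL_density _ _ _ dr) leeBlDr// /ent.
  rewrite (ge0_integral_density ps P gs mgs gs0 psE); first last.
  - by move=> x; rewrite lee_fin xlnx1_ge0.
  - exact/measurable_EFinP/measurable_xlnx1.
  (* Multiplied by gs, the integrand r ln r + 1 becomes [kl_integrand] plus g on the support; the g
     accounts for the shift by 1. *)
  rewrite (eq_integral ((fun x => (kl_integrand (gs x) (g x) + g x)%:E) \_ support)); last first.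
    move=> x _; rewrite patchE -EFinM; case: ifPn => [/set_mem/= gsx|].
      have gsp : (0 < gs x)%R by rewrite lt_neqAle eq_sym gs0 andbT; apply/eqP.
      congr EFin; rewrite /kl_integrand /r.
      have [->|gn0] := eqVneq (g x) 0%R; first by rewrite !mul0r; lra.
      have gp : (0 < g x)%R by rewrite lt_neqAle eq_sym gn0 g0.
      by rewrite ln_div ?posrE//; field; rewrite gt_eqF.
    by rewrite notin_setE/= => /contrapT/= ->; rewrite mulr0.
  rewrite -integral_mkcond; under eq_integral do rewrite EFinD.
  rewrite ge0_integralD//; first last.
  - exact/measurable_EFinP/measurable_funTS.
  - by move=> x _; rewrite lee_fin.
  - by apply/measurable_EFinP/measurable_funTS; exact: mkl.
  - move=> x gsx; rewrite lee_fin; apply: kl_integrand_ge0 => //.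
  apply: leeD; first exact: kl_support_le.
  rewrite -(density_integral1 _ _ _ dpi); apply: ge0_subset_integral => //.
  - exact/measurable_EFinP.
  - by move=> x _; rewrite lee_fin.
apply: (@le_trans _ _ (\int[ps]_x (c x)%:E + KL ps P + gap%:E)).
  by rewrite leeD2l.
have csf : \int[ps]_x (c x)%:E \is a fin_num.
  by rewrite ge0_fin_numE// integral_ge0// => x _; rewrite lee_fin.
have cif : \int[pi]_x (c x)%:E \is a fin_num.
  by rewrite ge0_fin_numE// integral_ge0// => x _; rewrite lee_fin.
have esf : ent P gs \is a fin_num by rewrite ge0_fin_numE// (le_trans _ (ent_ge1 _ _ _ dps)).
have eif : ent P g \is a fin_num by rewrite ge0_fin_numE// (le_trans _ (ent_ge1 _ _ _ dpi)).
rewrite (KL_density _ _ _ dps) (KL_density _ _ _ dpi) /gap.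
move: csf cif esf eif; case: (\int[ps]_x _) => // a; case: (\int[pi]_x _) => // b.
case: (ent P gs) => // e; case: (ent P g) => // f _ _ _ _.
by rewrite /= -!EFinB -!EFinD lee_fin; lra.
Qed.
End pythagoras.

(** * Shadows *)

Section image_measures.
Local Open Scope ereal_scope.
Context {d d'} {T : measurableType d} {T' : measurableType d'} {R : realType}.

Lemma pushforward_finite_measure (mu : {finite_measure set T' -> \bar R})
    (f : T' -> T) : measurable_fun setT f ->
  exists nu : {finite_measure set T -> \bar R}, forall A, nu A = mu (f @^-1` A).
Proof.
move=> mf; apply: exists_finite_measure => //.
- by rewrite preimage_set0 measure0.
- move=> F mF tF mUF; rewrite preimage_bigcup.
  apply: measure_semi_sigma_additive.
  + by move=> n; rewrite -[X in measurable X]setTI; exact: mf.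
  + apply/trivIsetP => /= i j _ _ ij; rewrite -preimage_setI.
    by move/trivIsetP : tF => /(_ _ _ _ _ ij) ->//; rewrite preimage_set0.
  + by rewrite -preimage_bigcup -[X in measurable X]setTI; exact: mf.
- by rewrite preimage_setT ltey_eq fin_num_measure.
Qed.

Lemma ge0_integral_image_in (mu : {measure set T' -> \bar R})
    (nu : {measure set T -> \bar R}) (phi : T' -> T) (h : T -> R) A :
  measurable_fun setT phi ->
  (forall B, measurable B -> nu B = mu (phi @^-1` B)) ->
  measurable_fun setT h -> (forall x, (0 <= h x)%R) -> measurable A ->
  \int[nu]_(x in A) (h x)%:E = \int[mu]_(x in phi @^-1` A) (h (phi x))%:E.
Proof.
move=> mphi nuE mh h0 mA; rewrite integral_mkcond [RHS]integral_mkcond.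
rewrite (ge0_integral_image mu nu phi _ mphi nuE).
- by apply: eq_integral => x _; rewrite !patchE.
- by apply/(measurable_restrictT _ mA)/measurable_EFinP/measurable_funTS.
- by move=> x; rewrite patchE; case: ifPn => // _; rewrite lee_fin.
Qed.

End image_measures.

Section shadow.
Local Open Scope ereal_scope.
Context {R : realType} {N : nat} {dX : 'I_N -> measure_display}.
Context {X : forall i, measurableType (dX i)}.

Let Y (i : 'I_N) : measurableType _ := (X i * X i)%type.

Let px (z : ProdX Y) : ProdX X := fun i => (z i).1.
Let py (z : ProdX Y) : ProdX X := fun i => (z i).2.

Let mpx : measurable_fun setT px.
Proof.
by apply: measurable_fun_ProdX => i; exact: (measurableT_comp measurable_fst (measurable_proj i)).
Qed.

Let mpy : measurable_fun setT py.
Proof.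
by apply: measurable_fun_ProdX => i; exact: (measurableT_comp measurable_snd (measurable_proj i)).
Qed.

Lemma product_image (d' : 'I_N -> measure_display) (X' : forall i, measurableType (d' i))
    (g : forall i, probability (X' i) R) (m : forall i, probability (X i) R) Gam P
    (phi : forall i, X' i -> X i) :
  (forall i, measurable_fun setT (phi i)) ->
  (forall i A, measurable A -> g i (phi i @^-1` A) = m i A) ->
  is_product_measure g Gam -> is_product_measure m P ->
  forall A, measurable A -> P A = Gam ((fun z i => phi i (z i)) @^-1` A).
Proof.
move=> mphi gm gGam mP.
have mpr : measurable_fun setT (fun z : ProdX X' => (fun i => phi i (z i)) : ProdX X).
  apply: measurable_fun_ProdX => i.
  exact: (measurableT_comp (mphi i) (measurable_proj i)).
have [Px PxE] := pushforward_probability Gam _ mpr.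
move=> A mA; rewrite -PxE; apply: measure_unique_box => // {mA}A mA.
rewrite [LHS](product_measure_box _ _ mP)// [RHS]PxE.
transitivity (Gam (box (fun i => phi i @^-1` A i))); last by [].
rewrite (product_measure_box _ _ gGam); last first.
  by move=> i; rewrite -[X in measurable X]setTI; exact: mphi.
by apply: eq_bigr => i _; rewrite gm.
Qed.

(** On the product of the spaces X_i * X_i, weight the product [Gam] of the [gam i] by [f] of the
    first components; [J] and [sh] are images of the weighted measure [G]. The entropy bound is data
    processing from first to second components. The last clause, which carries the transport costs,
    uses that [pi] has marginals [nu]. *)
Lemma shadow_coupling (nu rho : forall i, probability (X i) R)
    (P Q pi : probability (ProdX X) R)
    (gam : forall i, probability (X i * X i)%type R) (f : ProdX X -> R) :
  is_product_measure nu P -> is_product_measure rho Q ->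
  (forall i, coupling2 (nu i) (rho i) (gam i)) ->
  is_coupling nu pi -> is_density pi P f ->
  exists (sh : probability (ProdX X) R)
         (J : probability (ProdX X * ProdX X)%type R),
    [/\ is_coupling rho sh, coupling2 pi sh J, KL sh Q <= ent P f - 1 &
        forall i C, measurable C -> gam i C = J [set z | C (z.1 i, z.2 i)]].
Proof.
move=> nuP rhoQ cgam cpi [mf f0 fE].
have [Gam gamG] := @exists_product_measure R N _ Y gam.
have g1 i A : measurable A -> gam i (fst @^-1` A) = nu i A.
  move=> mA; have [<- _] := cgam i A mA; congr (gam i _).
  by apply/seteqP; split => [[x y]|[x y] []].
have g2 i A : measurable A -> gam i (snd @^-1` A) = rho i A.
  move=> mA; have [_ <-] := cgam i A mA; congr (gam i _).
  by apply/seteqP; split => [[x y]|[x y] []].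
have PE : forall A, measurable A -> P A = Gam (px @^-1` A).
  by apply: (product_image _ Y gam nu Gam P (fun i => fst)).
have QE : forall A, measurable A -> Q A = Gam (py @^-1` A).
  by apply: (product_image _ Y gam rho Gam Q (fun i => snd)).
have mfx : measurable_fun setT (fun z => f (px z)) by exact: (measurableT_comp mf mpx).
have piE A : measurable A -> pi A = \int[Gam]_(z in px @^-1` A) (f (px z))%:E.
  by move=> mA; rewrite fE// (ge0_integral_image_in Gam P px).
have [G GE] : exists G : probability (ProdX Y) R,
    forall A, G A = \int[Gam]_(z in A) (f (px z))%:E.
  apply: density_probability => //.
  by rewrite -(preimage_setT px) -piE//; exact: probability_setT.
have mpxy : measurable_fun setT (fun z => (px z, py z)) by exact: measurable_fun_pair.
have [sh shE] := pushforward_probability G _ mpy.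
have [J JE] := pushforward_probability G _ mpxy.
(* For one fixed C let g be the conditional probability of C given the first component under
   [gam i], a Radon-Nikodym density with respect to [nu i]. Then G(z_i in C) is the integral of f(x)
   g(x_i) against [P], that is of g(x_i) against [pi], that is of g against [nu i], which is
   [gam i C]. *)
have law i C : measurable C -> gam i C = G [set z | C (z i)].
  move=> mC.
  have mCi : measurable [set z : ProdX Y | C (z i)].
    by rewrite -[X in measurable X]setTI; exact: measurable_proj.
  have mCf : measurable_fun setT (\1_C : X i * X i -> R) by exact: measurable_indic.
  have mCif : measurable_fun setT (\1_[set z : ProdX Y | C (z i)] : ProdX Y -> R).
    exact: measurable_indic.
  have [g [mg gp gE]] : exists g : X i -> R, [/\ measurable_fun setT g,
      forall x, (0 <= g x)%R & forall A, measurable A ->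
        gam i ((fst @^-1` A) `&` C) = \int[nu i]_(x in A) (g x)%:E].
    have [m1 m1E] : exists m1 : {finite_measure set (X i * X i)%type -> \bar R},
        forall B, m1 B = \int[gam i]_(x in B) (\1_C x)%:E.
      apply: density_finite_measure => //.
      by rewrite integral_indic// setIT ltey_eq fin_num_measure.
    have [m2 m2E] := pushforward_finite_measure m1 _ measurable_fst.
    have m2E' A : measurable A -> m2 A = gam i ((fst @^-1` A) `&` C).
      move=> mA; rewrite m2E m1E integral_indic 1?setIC//.
      by rewrite -[X in measurable X]setTI; exact: measurable_fst.
    have [g [mg gp gE]] : exists g : X i -> R, [/\ measurable_fun setT g,
      forall x, (0 <= g x)%R & forall A, measurable A ->
        m2 A = \int[nu i]_(x in A) (g x)%:E].
      apply: exists_density => A mA A0; rewrite [LHS]m2E'//.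
      have mA1 : measurable (fst @^-1` A : set (X i * X i)).
        by rewrite -[X in measurable X]setTI; exact: measurable_fst.
      apply/eqP; rewrite eq_le measure_ge0 andbT -A0 -[leRHS]g1//.
      by apply: le_measure; rewrite ?inE//; exact: measurableI.
    by exists g; split => // A mA; rewrite -gE// m2E'.
  have mgi : measurable_fun setT (fun x : ProdX X => g (x i)).
    exact: (measurableT_comp mg (measurable_proj i)).
  have gnu : \int[nu i]_x (g x)%:E = gam i C.
    by rewrite -gE// preimage_setT setTI.
  have [nC nCE] : exists m : {finite_measure set (ProdX Y) -> \bar R},
      forall B, m B = \int[Gam]_(z in B) (\1_[set z | C (z i)] z)%:E.
    apply: density_finite_measure => //.
    by rewrite integral_indic// setIT ltey_eq fin_num_measure.
  have [m1 m1E] := pushforward_finite_measure nC _ mpx.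
  have [m2 m2E] : exists m : {finite_measure set (ProdX X) -> \bar R},
      forall B, m B = \int[P]_(x in B) (g (x i))%:E.
    apply: density_finite_measure => //.
    rewrite (integral_coupling nu P i (fun x => (g x)%:E))//; first last.
    - exact/measurable_EFinP.
    - exact: product_measure_coupling.
    by rewrite gnu ltey_eq fin_num_measure.
  (* The image under [px] of [Gam] restricted to {z_i in C} has density g(x_i) with respect to [P];
     only the i-th factor of a box feels the restriction. *)
  have m12 : forall A, measurable A -> m1 A = m2 A.
    apply: measure_unique_box => A mA; rewrite m1E nCE m2E.
    rewrite (integral_product_coord nu P i g A nuP mg gp mA) -gE//.
    rewrite integral_indic//; last first.
      by rewrite -[X in measurable X]setTI; exact: (mpx measurableT _ (measurable_box _ mA)).
    pose B := fun j => fst @^-1` A j : set (Y j).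
    have mB j : measurable (B j) by rewrite -[X in measurable X]setTI; exact: measurable_fst.
    transitivity (Gam (box (dfwith B i (B i `&` C)))).
      congr (Gam _); apply/seteqP; split => [z [Cz Az] j|z zB].
        have [<-|ij] := eqVneq i j; last by rewrite dfwithout//; exact: Az.
        by rewrite dfwithin; split => //; exact: Az.
      split; first by have := zB i; rewrite dfwithin => -[].
      move=> j; have [<-|ij] := eqVneq i j; first by have := zB i; rewrite dfwithin => -[].
      by have := zB j; rewrite dfwithout.
    rewrite (product_measure_box _ _ gamG); last first.
      by apply: measurable_dfwith => //; exact: measurableI.
    rewrite (bigD1 i)//= dfwithin; congr (_ * _); apply: eq_bigr => j ji.
    by rewrite dfwithout 1?eq_sym// g1.
  have fE0 x : 0 <= (f x)%:E by rewrite lee_fin.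
  have mfE : measurable_fun setT (fun x => (f x)%:E) by exact/measurable_EFinP.
  have gp0 (x : ProdX X) : 0 <= (g (x i))%:E by rewrite lee_fin.
  have mgiE : measurable_fun setT (fun x : ProdX X => (g (x i))%:E) by exact/measurable_EFinP.
  rewrite GE -gnu.
  transitivity (\int[pi]_x (g (x i))%:E).
    apply/esym/(integral_coupling nu pi i (fun x => (g x)%:E)) => //.
    exact/measurable_EFinP.
  rewrite (ge0_integral_density pi P f mf f0 fE _ mgiE)//.
  transitivity (\int[m2]_x (f x)%:E).
    rewrite (ge0_integral_density m2 P (fun x => g (x i)) mgi
      (fun x => gp (x i)) (fun A _ => m2E A))//.
    by apply: eq_integral => x _; rewrite muleC.
  transitivity (\int[m1]_x (f x)%:E).
    by apply: eq_measure_integral => A mA _; apply/esym; exact: (m12 A mA).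
  rewrite (ge0_integral_image nC m1 px _ mpx (fun A _ => m1E A))//.
  have mfxE : measurable_fun setT (fun z => (f (px z))%:E) by exact/measurable_EFinP.
  rewrite (ge0_integral_density nC Gam _ mCif (fun z => ltac:(by [])) (fun A _ => nCE A) _ mfxE)//.
  rewrite [RHS]integral_mkcond; apply: eq_integral => z _; rewrite patchE indicE.
  by case: (_ \in _); rewrite ?mule1 ?mule0.
exists sh, J; split.
- move=> i A mA; rewrite shE.
  transitivity (gam i (snd @^-1` A)); last exact: g2.
  by rewrite law//; rewrite -[X in measurable X]setTI; exact: measurable_snd.
- move=> A mA; rewrite !JE; split.
    transitivity (G (px @^-1` A)); last by rewrite GE piE.
    by congr (G _); apply/seteqP; split => [z []|z].
  by rewrite shE; congr (G _); apply/seteqP; split => [z []|z].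
- exact: (KL_data_processing Gam G px py P Q sh f).
- by move=> i C mC; rewrite JE law//; congr (G _); apply/seteqP;
    split => z /=; rewrite -surjective_pairing.
Qed.

End shadow.

(** * Power means and transport costs of the shadow *)

Section power_means.
Context {R : realType}.

(** Young's inequality for s^th and 1 with the conjugate exponents 1/th and 1/(1-th). *)
Lemma powR_bernoulli (s th : R) : 0 <= s -> 0 < th -> th <= 1 ->
  s `^ th <= 1 - th + th * s.
Proof.
move=> s0 th0; rewrite le_eqVlt => /predU1P[->|th1]; first by rewrite powRr1//; lra.
have th1' : 0 < 1 - th by rewrite subr_gt0.
have := @conjugate_powR R (s `^ th) 1 th^-1 (1 - th)^-1 (powR_ge0 _ _) ler01.
rewrite !invr_gt0 !invrK => /(_ th0 th1'); rewrite addrC subrK => /(_ erefl).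
rewrite mulr1 -powRrM divff ?gt_eqF// powRr1// powR1; lra.
Qed.

Lemma poweRK (x : \bar R) (p : R) : p != 0 -> (0 <= x)%E -> ((x `^ p) `^ p^-1 = x)%E.
Proof. by move=> p0 x0; rewrite -poweRrM mulfV// poweRe1. Qed.

Lemma poweRVK (x : \bar R) (p : R) : p != 0 -> (0 <= x)%E -> ((x `^ p^-1) `^ p = x)%E.
Proof. by move=> p0 x0; rewrite -poweRrM mulVf// poweRe1. Qed.

Lemma le_poweR (x y : \bar R) (r : R) : 0 <= r -> (0 <= x)%E -> (x <= y)%E ->
  (x `^ r <= y `^ r)%E.
Proof.
move=> r0 x0 xy; apply: gt0_ler_poweR => //; rewrite in_itv/= leey andbT//.
exact: le_trans xy.
Qed.

End power_means.

Section shadow_costs.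
Context {R : realType} {N : nat} {dX : 'I_N -> measure_display}.
Context {X : forall i, measurableType (dX i)}.
Variable dist : forall i, X i -> X i -> R.
Hypothesis Hdist : forall i, polish_borel (dist i).
Variables (gam : forall i, probability (X i * X i)%type R)
  (J : probability (ProdX X * ProdX X)%type R).
Hypothesis law : forall i C, measurable C ->
  gam i C = J [set z | C (z.1 i, z.2 i)].

Let dist_ge0 i x y : 0 <= dist i x y.
Proof. by have [[]] := Hdist i. Qed.

Let mcoord i : measurable_fun setT (fun z : ProdX X * ProdX X => (z.1 i, z.2 i)).
Proof.
apply: measurable_fun_pair.
  exact: (measurableT_comp (measurable_proj i) measurable_fst).
exact: (measurableT_comp (measurable_proj i) measurable_snd).
Qed.

Let mdp (r : R) i : measurable_fun setT
  (fun z : ProdX X * ProdX X => dist i (z.1 i) (z.2 i) `^ r).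
Proof. exact: (measurableT_comp (measurable_powR _) (measurable_dist_coord _ Hdist i)). Qed.

Let integral_coord i (r : R) :
  (\int[J]_z (dist i (z.1 i) (z.2 i) `^ r)%:E = \int[gam i]_z (dist i z.1 z.2 `^ r)%:E)%E.
Proof.
apply/esym; apply: (ge0_integral_image J (gam i) (fun z => (z.1 i, z.2 i)) _ (mcoord i) (law i)).
  apply/measurable_EFinP.
  exact: (measurableT_comp (measurable_powR _) (measurable_dist _ (Hdist i))).
by move=> z; rewrite lee_fin powR_ge0.
Qed.

Let dXr_pow (r : R) (x y : ProdX X) : 0 < r ->
  dXr dist r%:E x y `^ r = \sum_(i < N) dist i (x i) (y i) `^ r.
Proof.
move=> r0; rewrite /dXr -powRrM mulVf ?gt_eqF// powRr1//.
by apply: sumr_ge0 => i _; exact: powR_ge0.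
Qed.

Let wcost_le (q A : R) : 0 < q -> 0 <= A ->
  (\int[J]_z (\sum_(i < N) dist i (z.1 i) (z.2 i) `^ q)%:E <= (A `^ q)%:E)%E ->
  (wcost (dXr dist q%:E) q%:E J <= A%:E)%E.
Proof.
move=> q0 A0 H.
rewrite -(@poweRK _ A%:E q) ?gt_eqF// /wcost; apply: le_poweR.
- by rewrite invr_ge0 ltW.
- by apply: integral_ge0 => z _; rewrite lee_fin powR_ge0.
rewrite poweR_EFin (eq_integral (fun z : ProdX X * ProdX X =>
  (\sum_(i < N) dist i (z.1 i) (z.2 i) `^ q)%:E))//.
by move=> z _; rewrite dXr_pow.
Qed.

(* With M0 = N^(-1/p) M the Bernoulli inequality applied to (d_i / M0)^p bounds
   each d_i^q by an affine function of d_i^p, which is sharp enough to give the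
   power-mean factor N^(1/q - 1/p). *)
Lemma wcost_shadow_fin (p q M : R) : 1 <= q -> q <= p -> 0 < M ->
  (\sum_(i < N) \int[gam i]_z (dist i z.1 z.2 `^ p)%:E <= (M `^ p)%:E)%E ->
  (wcost (dXr dist q%:E) q%:E J <= (N%:R `^ (q^-1 - p^-1) * M)%:E)%E.
Proof.
move=> q1 qp M0 H.
have q0 : 0 < q by rewrite (lt_le_trans ltr01).
have p0 : 0 < p by rewrite (lt_le_trans q0).
apply: wcost_le => //; first by rewrite mulr_ge0 ?powR_ge0// ltW.
have [N0|Nn0] := eqVneq N 0%N.
  rewrite (eq_integral (cst 0%E)) ?integral0 ?lee_fin ?powR_ge0// => z _.
  by rewrite big1// => i; have := ltn_ord i; rewrite [X in (_ < X)%N -> _]N0.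
have Np : 0 < N%:R :> R by rewrite ltr0n lt0n.
pose M0' : R := N%:R `^ (- p^-1) * M.
have M0p : 0 < M0' by rewrite mulr_gt0// powR_gt0.
pose th := q / p.
have th0 : 0 < th by rewrite divr_gt0.
have th1 : th <= 1 by rewrite ler_pdivrMr// mul1r.
have MpE : M `^ p = N%:R * M0' `^ p.
  rewrite powRM ?powR_ge0// ?(ltW M0)// -powRrM mulNr mulVf ?gt_eqF//.
  by rewrite powR_inv1 ?ltW// mulrA divff ?gt_eqF// mul1r.
have targetE : (N%:R `^ (q^-1 - p^-1) * M) `^ q = N%:R * M0' `^ q.
  have -> : N%:R `^ (q^-1 - p^-1) * M = N%:R `^ q^-1 * M0'.
    by rewrite /M0' mulrA -powRD// (gt_eqF Np) implybT.
  rewrite powRM ?powR_ge0// ?(ltW M0p)//.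
  by rewrite -powRrM mulVf ?gt_eqF// powRr1// ltW.
(* These come from writing t^q as M0'^q times (t / M0')^p to the power th and applying
   [powR_bernoulli]. *)
pose a := M0' `^ q * (1 - th); pose b := M0' `^ q * th / M0' `^ p.
have a0 : 0 <= a by rewrite mulr_ge0 ?powR_ge0// subr_ge0.
have b0 : 0 <= b by rewrite divr_ge0 ?powR_ge0// mulr_ge0 ?powR_ge0// ltW.
have bern (t : R) : 0 <= t -> t `^ q <= a + b * t `^ p.
  move=> t0; have tM0 : 0 <= (t / M0') `^ p by exact: powR_ge0.
  have e1 : p * th = q by rewrite /th mulrCA divff ?gt_eqF// mulr1.
  have e2 : t `^ q = M0' `^ q * (t / M0') `^ q.
    by rewrite -powRM ?divr_ge0 ?(ltW M0p)// mulrCA divff ?gt_eqF// mulr1.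
  have e3 : (t / M0') `^ p = t `^ p * (M0' `^ p)^-1.
    rewrite powRM ?invr_ge0 ?(ltW M0p)//; congr (_ * _).
    by rewrite -(@powR_inv1 _ M0') ?(ltW M0p)// -powRrM mulN1r powRN.
  have := powR_bernoulli _ _ tM0 th0 th1; rewrite -powRrM e1 e3 => H1.
  have := ler_wpM2l (powR_ge0 M0' q) H1; rewrite -e2 => /le_trans; apply.
  by rewrite /a /b; move: (M0' `^ q) (t `^ p) (M0' `^ p)^-1 => u v w; lra.
pose S (z : ProdX X * ProdX X) := \sum_(i < N) dist i (z.1 i) (z.2 i) `^ p.
have S0 z : 0 <= S z by apply: sumr_ge0 => i _; exact: powR_ge0.
have mS : measurable_fun setT S by apply: measurable_sum => i; exact: mdp.
have bS0 z : 0 <= b * S z by rewrite mulr_ge0.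
have mbS : measurable_fun setT (fun z => b * S z) by exact: measurable_funM.
apply: (@le_trans _ _ (\int[J]_z (N%:R * a + b * S z)%:E)%E).
  apply: ge0_le_integral => //.
  - by move=> z _; rewrite lee_fin sumr_ge0// => i _; exact: powR_ge0.
  - by apply/measurable_EFinP; apply: measurable_sum => i; exact: mdp.
  - by apply/measurable_EFinP; exact: measurable_funD.
  move=> z _; rewrite lee_fin /S mulr_sumr.
  have -> : N%:R * a = \sum_(i < N) a by rewrite sumr_const card_ord mulr_natl.
  by rewrite -big_split/=; apply: ler_sum => i _; exact: bern.
have Na0 : 0 <= N%:R * a by rewrite mulr_ge0.
rewrite (integral_EFinD J setT measurableT (fun=> N%:R * a) (fun z => b * S z))//.
rewrite integral_probability_cst integral_EFinZ//.
have SE : (\int[J]_z (S z)%:E = \sum_(i < N) \int[gam i]_z (dist i z.1 z.2 `^ p)%:E)%E.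
  under eq_integral do rewrite -sumEFin.
  rewrite ge0_integral_sum//.
  - by apply: eq_bigr => i _; exact: integral_coord.
  - by move=> i; apply/measurable_EFinP; exact: mdp.
  - by move=> i z _; rewrite lee_fin powR_ge0.
(* Since M^p = N M0'^p, the weights 1 - th and th add up again and leave N M0'^q. *)
apply: (@le_trans _ _ ((N%:R * a)%:E + b%:E * (M `^ p)%:E)%E).
  by rewrite leeD2l// lee_wpmul2l ?lee_fin// SE.
rewrite -EFinM -EFinD lee_fin targetE MpE /a /b.
have Mn0 : M0' `^ p != 0 by rewrite gt_eqF// powR_gt0.
rewrite (_ : M0' `^ q * th / M0' `^ p * (N%:R * M0' `^ p) = M0' `^ q * th * N%:R); last first.
  by field.
by move: (M0' `^ q) (N%:R : R) => u v; lra.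
Qed.

Let coord_ae (M : R) :
  (forall i, (ess_sup (gam i) (fun z => (dist i z.1 z.2)%:E) <= M%:E)%E) ->
  {ae J, forall z, forall i, dist i (z.1 i) (z.2 i) <= M}.
Proof.
move=> H; apply: filter_forall => i.
have [B [mB B0 BP]] := ess_sup_ge (gam i) (fun z => (dist i z.1 z.2)%:E).
exists ((fun z : ProdX X * ProdX X => (z.1 i, z.2 i)) @^-1` B); split.
- by rewrite -[X in measurable X]setTI; exact: mcoord.
- by rewrite -[LHS]law.
- move=> z /= zM; apply: BP => /= zz; apply: zM.
  by rewrite -lee_fin (le_trans zz).
Qed.

Lemma wcost_shadow_pinfty (M : R) : 0 <= M ->
  (forall i, (ess_sup (gam i) (fun z => (dist i z.1 z.2)%:E) <= M%:E)%E) ->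
  (wcost (dXr dist +oo%E) +oo%E J <= M%:E)%E.
Proof.
move=> M0 H; apply/ess_supP; have [B [mB B0 BP]] := coord_ae _ H.
exists B; split => // z /= nz; apply: BP => /= zM; apply: nz.
by rewrite lee_fin; exact: bigmax_le.
Qed.

(** Almost surely all coordinate distances are at most M, so their q-th powers sum to at most N
    M^q. *)
Lemma wcost_shadow_fin_pinfty (q M : R) : 1 <= q -> 0 <= M ->
  (forall i, (ess_sup (gam i) (fun z => (dist i z.1 z.2)%:E) <= M%:E)%E) ->
  (wcost (dXr dist q%:E) q%:E J <= (N%:R `^ q^-1 * M)%:E)%E.
Proof.
move=> q1 M0 H.
have q0 : 0 < q by rewrite (lt_le_trans ltr01).
apply: wcost_le => //; first by rewrite mulr_ge0 ?powR_ge0.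
rewrite powRM ?powR_ge0// -powRrM mulVf ?gt_eqF// powRr1//.
rewrite -(integral_probability_cst J (N%:R * M `^ q)).
apply: ae_ge0_le_integral => //.
- by move=> z _; rewrite lee_fin sumr_ge0// => i _; exact: powR_ge0.
- by apply/measurable_EFinP; apply: measurable_sum => i; exact: mdp.
- by move=> z _; rewrite lee_fin mulr_ge0 ?powR_ge0.
have [B [mB B0 BP]] := coord_ae _ H.
exists B; split => // z /= nz; apply: BP => /= zM; apply: nz => _; rewrite lee_fin.
rewrite (_ : N%:R * M `^ q = \sum_(i < N) M `^ q); last by rewrite sumr_const card_ord mulr_natl.
by apply: ler_sum => i _; apply: ge0_ler_powR; rewrite ?nnegrE// ltW.
Qed.

End shadow_costs.

(** * Nearly optimal couplings and existence of shadows *)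

Section near_optimal.
Context {R : realType} {N : nat} {dX : 'I_N -> measure_display}.
Context {X : forall i, measurableType (dX i)}.
Variable dist : forall i, X i -> X i -> R.
Hypothesis Hdist : forall i, polish_borel (dist i).
Implicit Types nu rho : forall i, probability (X i) R.

Let dist_ge0 i x y : 0 <= dist i x y.
Proof. by have [[]] := Hdist i. Qed.

Lemma Delta_ge0 p nu rho : (0 <= Delta dist p nu rho)%E.
Proof.
case: p => [p| |] /=; first exact: poweR_ge0.
- by elim/big_ind : _ => // [a b a0 b0|i _]; [rewrite le_max a0|exact: Wass_ge0].
- by elim/big_ind : _ => // [a b a0 b0|i _]; [rewrite le_max a0|exact: Wass_ge0].
Qed.

Lemma Delta_sym p nu rho : Delta dist p nu rho = Delta dist p rho nu.
Proof.
have W q i : Wass (dist i) q (nu i) (rho i) = Wass (dist i) q (rho i) (nu i).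
  by apply: Wass_sym => //; [exact: measurable_dist|have [[]] := Hdist i].
by case: p => [p| |] /=; [congr (_ `^ _)%E| |]; apply: eq_bigr => i _; rewrite W.
Qed.

Lemma near_optimal_fin (p M : R) nu rho : 1 <= p ->
  (Delta dist p%:E nu rho < M%:E)%E ->
  exists gam : forall i, probability (X i * X i)%type R,
    (forall i, coupling2 (nu i) (rho i) (gam i)) /\
    (\sum_(i < N) \int[gam i]_z (dist i z.1 z.2 `^ p)%:E <= (M `^ p)%:E)%E.
Proof.
move=> p1 DM; have p0 : 0 < p by rewrite (lt_le_trans ltr01).
have pn0 : p != 0 by rewrite gt_eqF.
have M0 : 0 < M by rewrite -lte_fin (le_lt_trans (Delta_ge0 _ _ _) DM).
pose W i := Wass (dist i) p%:E (nu i) (rho i).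
have W0 i : (0 <= W i)%E by exact: Wass_ge0.
have SM : (\sum_(i < N) W i `^ p < (M `^ p)%:E)%E.
  rewrite ltNge; apply/negP => MS; move: DM; rewrite ltNge => /negP; apply.
  rewrite /Delta -(@poweRK _ M%:E p)// ?poweR_EFin; last by rewrite lee_fin ltW.
  apply: le_poweR MS; first by rewrite invr_ge0 ltW.
  by rewrite lee_fin powR_ge0.
have Wf i : (W i `^ p)%E \is a fin_num.
  rewrite ge0_fin_numE ?poweR_ge0// (le_lt_trans _ (lt_trans SM (ltry _)))//.
  rewrite (bigD1 i)//= leeDl// sume_ge0// => j _; exact: poweR_ge0.
pose w i := fine (W i `^ p)%E.
have SE : (\sum_(i < N) W i `^ p = (\sum_(i < N) w i)%:E)%E.
  by rewrite -sumEFin; apply: eq_bigr => i _; rewrite fineK.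
rewrite SE lte_fin in SM.
(* The strict inequality Delta < M leaves a slack to share among the coordinates; N + 1 shares avoid
   a division by 0 when N = 0. *)
pose del := (M `^ p - \sum_(i < N) w i) / N.+1%:R.
have del0 : 0 < del by rewrite divr_gt0// ?subr_gt0// ltr0n.
have ex i : exists g, coupling2 (nu i) (rho i) g /\
    (\int[g]_z (dist i z.1 z.2 `^ p)%:E <= (w i + del)%:E)%E.
  apply: contrapT => nex.
  (* If every coupling had p-cost above w i + del, so would the infimum, contradicting that w i is
     the p-th power of the distance. *)
  have : (((w i + del)%:E) `^ p^-1 <= W i)%E.
    apply/ereal_infP => _ [g [cg ->]]; rewrite /wcost; apply: le_poweR.
    - by rewrite invr_ge0 ltW.
    - by rewrite lee_fin addr_ge0 ?(ltW del0)// fine_ge0// poweR_ge0.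
    - by rewrite leNgt; apply/negP => /ltW lt; apply: nex; exists g.
  move=> /(le_poweR _ _ p (ltW p0) (poweR_ge0 _ _)).
  rewrite poweRVK//; last by rewrite lee_fin addr_ge0 ?(ltW del0)// fine_ge0// poweR_ge0.
  by rewrite -(fineK (Wf i)) lee_fin gerDl leNgt del0.
pose gam i := sval (cid (ex i)).
have gamP i : coupling2 (nu i) (rho i) (gam i) /\
    (\int[gam i]_z (dist i z.1 z.2 `^ p)%:E <= (w i + del)%:E)%E.
  by rewrite /gam; case: cid.
exists gam; split => [i|]; first by have [] := gamP i.
apply: (@le_trans _ _ (\sum_(i < N) (w i + del)%:E)%E).
  by apply: lee_sum => i _; have [] := gamP i.
rewrite sumEFin lee_fin big_split/= sumr_const card_ord -mulr_natl.
have : N.+1%:R * del = M `^ p - \sum_(i < N) w i.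
  by rewrite mulrC divfK// pnatr_eq0.
by rewrite -natr1; move: (N%:R : R) (\sum_(i < N) w i) => u v; lra.
Qed.

Lemma near_optimal_pinfty (M : R) nu rho : (Delta dist +oo%E nu rho < M%:E)%E ->
  exists gam : forall i, probability (X i * X i)%type R,
    (forall i, coupling2 (nu i) (rho i) (gam i)) /\
    forall i, (ess_sup (gam i) (fun z => (dist i z.1 z.2)%:E) <= M%:E)%E.
Proof.
move=> /bigmax_ltP[_ DM].
have ex i : exists g, coupling2 (nu i) (rho i) g /\
    (ess_sup g (fun z => (dist i z.1 z.2)%:E) <= M%:E)%E.
  have /ereal_inf_lt[_ [g [cg ->]] gM] := DM i isT.
  by exists g; split => //; exact: ltW.
exists (fun i => sval (cid (ex i))).
by split => i; case: cid => g [].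
Qed.

(** For finite p the W_p bound is the W_q estimate at q = p, where the power of N has exponent 0; p
    = +oo goes through essential suprema. *)
Lemma exists_shadow (p : \bar R) (q M : R) nu rho P Q pi f :
  (1%:E <= p)%E -> 1 <= q -> (q%:E <= p)%E ->
  (Delta dist p nu rho < M%:E)%E ->
  is_product_measure nu P -> is_product_measure rho Q ->
  is_coupling nu pi -> is_density pi P f ->
  exists sh, [/\ is_coupling rho sh, (KL sh Q <= KL pi P)%E,
    (WX dist p pi sh <= M%:E)%E &
    (WX dist q%:E pi sh <= (N%:R `^ (q^-1 - einv p) * M)%:E)%E].
Proof.
move=> p1 q1 qp DM nuP rhoQ cpi df.
have M0 : 0 < M by rewrite -lte_fin (le_lt_trans (Delta_ge0 _ _ _) DM).
rewrite (KL_density _ _ _ df).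
case: p p1 qp DM => [p| |] p1 qp DM //.
- rewrite !lee_fin in p1 qp.
  have [gam [cgam gamM]] := near_optimal_fin _ _ _ _ p1 DM.
  have [sh [J [csh cJ KLsh law]]] := shadow_coupling _ _ _ _ _ _ _ nuP rhoQ cgam cpi df.
  have Wle r A : (wcost (dXr dist r) r J <= A)%E -> (WX dist r pi sh <= A)%E.
    by apply: le_trans; apply: ereal_inf_lbound; exists J.
  exists sh; split => //; apply: Wle.
  + have := wcost_shadow_fin dist Hdist gam J law p p M p1 (lexx p) M0 gamM.
    by rewrite subrr powRr0 mul1r.
  + exact: (wcost_shadow_fin dist Hdist gam J law p q M).
- have [gam [cgam gamM]] := near_optimal_pinfty _ _ _ DM.
  have [sh [J [csh cJ KLsh law]]] := shadow_coupling _ _ _ _ _ _ _ nuP rhoQ cgam cpi df.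
  have Wle r A : (wcost (dXr dist r) r J <= A)%E -> (WX dist r pi sh <= A)%E.
    by apply: le_trans; apply: ereal_inf_lbound; exists J.
  exists sh; split => //; apply: Wle.
  + exact: (wcost_shadow_pinfty dist gam J law M (ltW M0)).
  + rewrite /einv subr0.
    exact: (wcost_shadow_fin_pinfty dist Hdist gam J law q M q1 (ltW M0)).
Qed.

End near_optimal.

(** * Stability of the optimizer *)

Section cost_moments.
Context {R : realType} {N : nat} {dX : 'I_N -> measure_display}.
Context {X : forall i, measurableType (dX i)}.
Variable dist : forall i, X i -> X i -> R.
Hypothesis Hdist : forall i, polish_borel (dist i).

Let dist_ge0 i x y : 0 <= dist i x y.
Proof. by have [[]] := Hdist i. Qed.

Lemma measurable_dXr_ext (r : \bar R) :
  measurable_fun setT (fun z : ProdX X * ProdX X => dXr dist r z.1 z.2).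
Proof.
have mmax (s : seq 'I_N) : measurable_fun setT (fun z : ProdX X * ProdX X =>
    \big[Num.max/0]_(i <- s) dist i (z.1 i) (z.2 i)).
  elim: s => [|i s ih].
    by apply: (eq_measurable_fun (fun=> 0 : R)) => [z _|]; rewrite ?big_nil.
  apply: (eq_measurable_fun (fun z : ProdX X * ProdX X => Num.max
      (dist i (z.1 i) (z.2 i)) (\big[Num.max/0]_(j <- s) dist j (z.1 j) (z.2 j)))).
    by move=> z _; rewrite big_cons.
  by apply: measurable_maxr => //; exact: measurable_dist_coord.
by case: r => [r| |]; [exact: (measurable_dXr dist Hdist)|exact: mmax|exact: mmax].
Qed.

Lemma WX_sym (r : \bar R) (pi th : probability (ProdX X) R) :
  WX dist r pi th = WX dist r th pi.
Proof.
by apply: Wass_sym; [exact: measurable_dXr_ext|exact: (dXr_sym dist Hdist)].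
Qed.

Lemma WX_triangle (q : R) (pi th rho : probability (ProdX X) R) : 1 <= q ->
  (WX dist q%:E pi rho <= WX dist q%:E pi th + WX dist q%:E th rho)%E.
Proof.
move=> q1; apply: Wass_triangle => //.
- exact: (dXr_ge0 dist Hdist).
- exact: (measurable_dXr dist Hdist).
- by move=> x y z; exact: (dXr_triangle dist Hdist).
- by move=> e e0; exact: (exists_discretization_dXr dist Hdist).
Qed.

(** A finite moment about one base point is finite about any other, since (u + v)^p <= 2^p (u^p +
    v^p). *)
Lemma moment_lty i (p : R) (m : probability (X i) R) (a : X i) : 1 <= p ->
  Pp (dist i) p%:E m -> (\int[m]_x (dist i x a `^ p)%:E < +oo)%E.
Proof.
move=> p1 [x0 x0oo]; have p0 : 0 <= p by rewrite (le_trans ler01).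
have [[_ _ dC dD] _ _ _] := Hdist i.
have md b : measurable_fun setT (fun x => dist i b x `^ p).
  exact: (measurableT_comp (measurable_powR _) (measurable_dist1 _ (Hdist i) b)).
apply: (@le_lt_trans _ _
    (\int[m]_x (2 `^ p * (dist i x0 x `^ p) + 2 `^ p * dist i x0 a `^ p)%:E)%E).
  apply: ge0_le_integral => //.
  - by move=> x _; rewrite lee_fin powR_ge0.
  - by apply/measurable_EFinP; apply: (eq_measurable_fun (fun x => dist i a x `^ p)) => // x _;
      rewrite dC.
  - by apply/measurable_EFinP; apply: measurable_funD => //; exact: measurable_funM.
  move=> x _; rewrite lee_fin -mulrDr.
  have xa : dist i x a <= dist i x0 x + dist i x0 a.
    by rewrite (le_trans (dD _ x0 _))// (dC x).
  set u := dist i x0 x in xa *; set v := dist i x0 a in xa *.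
  have u0 : 0 <= u by exact: dist_ge0.
  have v0 : 0 <= v by exact: dist_ge0.
  have H (s : R) : 0 <= s -> u <= s -> v <= s -> dist i x a `^ p <= 2 `^ p * s `^ p.
    move=> s0 us vs; rewrite -powRM//; apply: ge0_ler_powR; rewrite ?nnegrE ?mulr_ge0//.
    by rewrite (le_trans xa)//; lra.
  have [uv|/ltW vu] := leP u v.
    by rewrite (le_trans (H v _ _ _))// ler_wpM2l ?powR_ge0// lerDr powR_ge0.
  by rewrite (le_trans (H u _ _ _))// ler_wpM2l ?powR_ge0// lerDl powR_ge0.
have d0 x : 0 <= dist i x0 x `^ p by exact: powR_ge0.
have dd0 x : 0 <= 2 `^ p * dist i x0 x `^ p by rewrite mulr_ge0 ?powR_ge0.
have mdd : measurable_fun setT (fun x => 2 `^ p * dist i x0 x `^ p) by exact: measurable_funM.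
rewrite (integral_EFinD m setT measurableT (fun x => 2 `^ p * dist i x0 x `^ p)
  (fun=> 2 `^ p * dist i x0 a `^ p))//.
rewrite integral_probability_cst integral_EFinZ ?powR_ge0//.
by rewrite lte_add_pinfty ?ltry// lte_mul_pinfty// lee_fin powR_ge0.
Qed.

(** For finite p, growth bounds [c] by a sum of functions of single coordinates, whose integrals
    depend on the marginals only; hence the cost is finite for every coupling. For p = +oo, [c] is
    bounded. *)
Lemma integral_cost_lty (p : \bar R) (c : ProdX X -> R)
    (m : forall i, probability (X i) R) (pi : probability (ProdX X) R) :
  (1%:E <= p)%E -> (forall x, 0 <= c x) -> measurable_fun setT c ->
  growth_order dist p c -> (forall i, Pp (dist i) p (m i)) -> is_coupling m pi ->
  (\int[pi]_x (c x)%:E < +oo)%E.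
Proof.
move=> p1 c0 mc gc mP cpi; case: p p1 gc mP => [p| |]// p1.
  rewrite lee_fin in p1; move=> [C [xh gc]] mP.
  have p0 : 0 < p by rewrite (lt_le_trans ltr01).
  pose S (x : ProdX X) := \sum_(i < N) dist i (x i) (xh i) `^ p.
  have mdx i : measurable_fun setT (fun t => dist i t (xh i) `^ p).
    have [[_ _ dC _] _ _ _] := Hdist i.
    apply: (eq_measurable_fun (fun t => dist i (xh i) t `^ p)) => [t _|]; first by rewrite dC.
    exact: (measurableT_comp (measurable_powR _) (measurable_dist1 _ (Hdist i) (xh i))).
  have mS1 i : measurable_fun setT (fun x : ProdX X => dist i (x i) (xh i) `^ p).
    exact: (measurableT_comp (mdx i) (measurable_proj i)).
  have mS : measurable_fun setT S by apply: measurable_sum => i; exact: mS1.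
  have S0 x : 0 <= S x by apply: sumr_ge0 => i _; exact: powR_ge0.
  apply: (@le_lt_trans _ _ (\int[pi]_x (`|C| + `|C| * S x)%:E)%E).
    apply: ge0_le_integral => //.
    - by move=> x _; rewrite lee_fin.
    - exact/measurable_EFinP.
    - by apply/measurable_EFinP; apply: measurable_funD => //; exact: measurable_funM.
    move=> x _; rewrite lee_fin; have := gc x; rewrite ger0_norm// => /le_trans; apply.
    rewrite -[X in _ <= X + _]mulr1 -mulrDr.
    have -> : dXr dist p%:E x xh `^ p = S x.
      by rewrite /dXr -powRrM mulVf ?gt_eqF// powRr1//; exact: S0.
    by rewrite ler_wpM2r ?addr_ge0// ler_norm.
  rewrite (integral_EFinD pi setT measurableT (fun=> `|C|) (fun x => `|C| * S x))//; last 2 first.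
    exact: measurable_funM.
    by move=> x; rewrite mulr_ge0.
  rewrite integral_probability_cst integral_EFinZ//.
  rewrite lte_add_pinfty ?ltry// lte_mul_pinfty ?lee_fin//.
  under eq_integral do rewrite -sumEFin.
  rewrite ge0_integral_sum//; last 2 first.
    by move=> i; apply/measurable_EFinP; exact: mS1.
    by move=> i x _; rewrite lee_fin powR_ge0.
  apply: lte_sum_pinfty => i _.
  rewrite (integral_coupling m pi i (fun t => (dist i t (xh i) `^ p)%:E) cpi).
  - exact: moment_lty.
  - exact/measurable_EFinP.
  - by move=> x; rewrite lee_fin powR_ge0.
move=> [C gc] _; apply: (@le_lt_trans _ _ `|C|%:E%E); last exact: ltry.
rewrite -(integral_probability_cst pi `|C|); apply: ge0_le_integral => //.
- by move=> x _; rewrite lee_fin.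
- exact/measurable_EFinP.
- by move=> x _; rewrite lee_fin (le_trans (ler_norm _))// (le_trans (gc x))// ler_norm.
Qed.

End cost_moments.

(** * Letting M decrease to Delta *)

Section right_limit.
Context {R : realType}.

Lemma powR_cvg_right (s a : R) : 0 < s -> 0 <= a ->
  x `^ s @[x --> a^'+] --> a `^ s.
Proof.
move=> s0; rewrite le_eqVlt => /predU1P[<-|a0].
  by rewrite powR0 ?gt_eqF//; exact: powR_cvg0.
apply: cvg_at_right_filter.
have : derivable (@powR R ^~ s) a 1 by apply: derivable_powR; rewrite in_itv/= a0.
by move=> /derivable1_diffP/differentiable_continuous.
Qed.

(** Two power terms cover both estimates. The limit is taken from the right only, as the bound is
    known for M above [dl], and [dl] may be 0. *)
Lemma le_right_limit (w : \bar R) (a b b' s s' dl : R) : 0 < s -> 0 < s' -> 0 <= dl ->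
  (forall M, dl < M -> (w <= (a * M + b * M `^ s + b' * M `^ s')%:E)%E) ->
  (w <= (a * dl + b * dl `^ s + b' * dl `^ s')%:E)%E.
Proof.
move=> s0 s'0 dl0 H.
have dl1 : dl < dl + 1 by rewrite ltrDl.
case: w H => [w| |] H; last by rewrite leNye.
  rewrite lee_fin.
  have cvgh : (a * M + b * M `^ s + b' * M `^ s') @[M --> dl^'+] -->
      (a * dl + b * dl `^ s + b' * dl `^ s').
    apply: cvgD; [apply: cvgD|]; apply: cvgM; try exact: cvg_cst.
    - by apply: cvg_at_right_filter; exact: cvg_id.
    - exact: powR_cvg_right.
    - exact: powR_cvg_right.
  apply: (cvgr_to_ge cvgh).
  near=> M; rewrite -lee_fin; apply: H; near: M; exact: nbhs_right_gt.
by have := H _ dl1; rewrite leye_eq.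
Unshelve. all: by end_near. Qed.

End right_limit.

Section stability.
Context {R : realType} {N : nat} {dX : 'I_N -> measure_display}.
Context {X : forall i, measurableType (dX i)}.
Variable dist : forall i, X i -> X i -> R.
Hypothesis Hdist : forall i, polish_borel (dist i).
Variables (p : \bar R) (q : R) (c : ProdX X -> R).
Hypotheses (Hp : (1%:E <= p)%E) (Hq1 : 1 <= q) (Hqp : (q%:E <= p)%E).
Hypotheses (Hc0 : forall x, 0 <= c x) (Hcc : cost_continuous dist c)
  (Hcg : growth_order dist p c).
Variables (mu mu' : forall i, probability (X i) R)
  (P P' pi pi' : probability (ProdX X) R) (L : R).
Hypotheses (Hmu : forall i, Pp (dist i) p (mu i)) (Hmu' : forall i, Pp (dist i) p (mu' i)).
Hypotheses (HP : is_product_measure mu P) (HP' : is_product_measure mu' P').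
Hypotheses (HL : 0 <= L) (HA : cond_A dist p c L mu mu').
Hypotheses (opt : is_Sent_optimizer mu P c pi) (opt' : is_Sent_optimizer mu' P' c pi').

Let mc : measurable_fun setT c. Proof. exact: (measurable_cost dist Hdist). Qed.

Let cost_fin (m : forall i, probability (X i) R) (th : probability (ProdX X) R) :
  (forall i, Pp (dist i) p (m i)) -> is_coupling m th ->
  (\int[th]_x (c x)%:E)%E \is a fin_num.
Proof.
move=> mP cth; rewrite ge0_fin_numE; last by apply: integral_ge0 => x _; rewrite lee_fin.
exact: (integral_cost_lty dist Hdist p c m).
Qed.

(** The product measure is a competitor with zero entropy and finite cost, so the optimal value is
    finite. *)
Let KL_opt_fin (m : forall i, probability (X i) R) (Q th : probability (ProdX X) R) :
  (forall i, Pp (dist i) p (m i)) -> is_product_measure m Q ->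
  is_Sent_optimizer m Q c th -> KL th Q \is a fin_num.
Proof.
move=> mP mQ [cth thE]; rewrite ge0_fin_numE ?KL_ge0//.
have cQ : is_coupling m Q by exact: product_measure_coupling.
have : (\int[th]_x (c x)%:E + KL th Q <= \int[Q]_x (c x)%:E)%E.
  rewrite thE; apply: ereal_inf_lbound; exists Q; split => //.
  by rewrite KL_self adde0.
rewrite -(fineK (cost_fin _ _ mP cth)) -(fineK (cost_fin _ _ mP cQ)).
by case: (KL th Q) => // r; rewrite ltry.
Qed.

(** With F and F' the two objectives and sh, sh' the shadows of [pi'] and [pi]: F(sh) <= F'(pi') + L
    M <= F'(sh') + L M <= F(pi) + 2 L M. The outer steps combine (A_L) with the entropy bound for a
    shadow, the middle one is optimality of [pi']; [KL_pythagoras] does the rest. *)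
Lemma exists_close_competitor (M : R) : (Delta dist p mu mu' < M%:E)%E ->
  exists sh, [/\ is_coupling mu sh, (KL sh pi <= (2 * L * M)%:E)%E &
    (WX dist q%:E sh pi' <= (N%:R `^ (q^-1 - einv p) * M)%:E)%E].
Proof.
move=> DM; have [cpi piE] := opt; have [cpi' piE'] := opt'.
have KLf := KL_opt_fin _ _ _ Hmu HP opt.
have KLf' := KL_opt_fin _ _ _ Hmu' HP' opt'.
have KLlty : (KL pi P < +oo)%E by rewrite ltey_eq KLf.
have KLlty' : (KL pi' P' < +oo)%E by rewrite ltey_eq KLf'.
have [f df] := exists_KL_density _ _ KLlty.
have [f' df'] := exists_KL_density _ _ KLlty'.
have DM' : (Delta dist p mu' mu < M%:E)%E by rewrite (Delta_sym dist Hdist).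
have [sh [csh KLsh Wsh Wsh_q]] :=
  exists_shadow dist Hdist p q M mu' mu P' P pi' f' Hp Hq1 Hqp DM' HP' HP cpi' df'.
have [sh' [csh' KLsh' Wsh' _]] :=
  exists_shadow dist Hdist p q M mu mu' P P' pi f Hp Hq1 Hqp DM HP HP' cpi df.
have cf := cost_fin _ _ Hmu cpi; have cf' := cost_fin _ _ Hmu' cpi'.
have csf := cost_fin _ _ Hmu csh; have csf' := cost_fin _ _ Hmu' csh'.
have KLshf : KL sh P \is a fin_num.
  by rewrite ge0_fin_numE ?KL_ge0// (le_lt_trans KLsh).
have KLshf' : KL sh' P' \is a fin_num.
  by rewrite ge0_fin_numE ?KL_ge0// (le_lt_trans KLsh').
exists sh; split => //; last by rewrite (WX_sym dist Hdist).
have LW : (L%:E * WX dist p sh pi' <= (L * M)%:E)%E.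
  by rewrite EFinM lee_wpmul2l ?lee_fin// (WX_sym dist Hdist).
have LW' : (L%:E * WX dist p pi sh' <= (L * M)%:E)%E.
  by rewrite EFinM lee_wpmul2l ?lee_fin.
have A1 := le_trans (HA sh pi' csh cpi') LW.
have A2 := le_trans (HA pi sh' cpi csh') LW'.
have O : (\int[pi']_x (c x)%:E + KL pi' P' <= \int[sh']_x (c x)%:E + KL sh' P')%E.
  by rewrite piE'; apply: ereal_inf_lbound; exists sh'.
have KLshlty : (KL sh P < +oo)%E by rewrite ltey_eq KLshf.
have [h dh] := exists_KL_density _ _ KLshlty.
have ent_lty (th : probability (ProdX X) R) g : is_density th P g ->
    (KL th P < +oo)%E -> (ent P g < +oo)%E.
  move=> dg; rewrite (KL_density _ _ _ dg); case: (ent P g) => // r _; exact: ltry.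
have Pyth : (\int[pi]_x (c x)%:E + KL pi P + KL sh pi <= \int[sh]_x (c x)%:E + KL sh P)%E.
  apply: (KL_pythagoras P pi sh f h c df dh mc Hc0).
  - by rewrite ltey_eq cf.
  - by rewrite ltey_eq csf.
  - exact: ent_lty df KLlty.
  - exact: ent_lty dh KLshlty.
  (* A mixture of couplings of [mu] is again a coupling of [mu], so the optimizer is tested along
     the whole segment. *)
  move=> t rho t0 t1 rhoE; rewrite piE; apply: ereal_inf_lbound; exists rho; split => // i A mA.
  rewrite rhoE; last first.
    by rewrite -[X in measurable X]setTI; exact: (measurable_proj i measurableT A mA).
  have mf : mu i A \is a fin_num by rewrite fin_num_measure.
  by rewrite cpi// csh// -(fineK mf) -!EFinM -EFinD; congr EFin; ring.
have KLspf : KL sh pi \is a fin_num.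
  rewrite ge0_fin_numE ?KL_ge0// ltNge leye_eq; apply/negP => /eqP KLoo.
  move: Pyth; rewrite KLoo -(fineK cf) -(fineK KLf) -(fineK csf) -(fineK KLshf).
  by rewrite -!EFinD addey// leye_eq.
move: A1 A2 O Pyth KLsh KLsh'.
rewrite -(fineK cf) -(fineK cf') -(fineK csf) -(fineK csf') -(fineK KLf) -(fineK KLf').
rewrite -(fineK KLshf) -(fineK KLshf') -(fineK KLspf) -!EFinB -!EFinD !lee_fin !ler_norml.
by move=> /andP[? ?] /andP[? ?] ? ? ? ?; lra.
Qed.

(** The common end of both estimates; [Phi] stands for the bound that (I_q) or (I'_q) supplies. *)
Lemma stability_le (M : R) (Phi : \bar R) : (Delta dist p mu mu' < M%:E)%E ->
  (forall th, is_coupling mu th -> (KL th pi <= (2 * L * M)%:E)%E ->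
     (WX dist q%:E pi th <= Phi)%E) ->
  (WX dist q%:E pi pi' <= (N%:R `^ (q^-1 - einv p) * M)%:E + Phi)%E.
Proof.
move=> DM HPhi; have [sh [csh KLsh Wsh]] := exists_close_competitor M DM.
apply: (le_trans (WX_triangle dist Hdist q pi sh pi' Hq1)).
by rewrite addeC leeD// HPhi.
Qed.

(** An infinite Delta rules out N = 0, so the power of N is positive and the convention 0 * oo = 0
    does no harm. *)
Lemma Delta_pinfty : (Delta dist p mu mu' = +oo)%E ->
  ((N%:R `^ (q^-1 - einv p))%:E * Delta dist p mu mu' = +oo)%E.
Proof.
move=> Doo; rewrite Doo gt0_muley// lte_fin powR_gt0// ltr0n lt0n.
apply/negP => /eqP N0; move: Doo.
have empty (i : 'I_N) : False by have := ltn_ord i; rewrite [X in (_ < X)%N -> _]N0.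
case: p Hp => [r| |]// r1.
- rewrite /Delta big1 => [|i _]; last by case: (empty i).
  rewrite poweR0r// invr_eq0 gt_eqF//.
  by rewrite lee_fin in r1; rewrite (lt_le_trans ltr01).
- have : (Delta dist +oo%E mu mu' <= 0)%E by apply: bigmax_le => // i; case: (empty i).
  by move=> /[swap] ->; rewrite leye_eq.
Qed.

Let q0 : 0 < q. Proof. exact: lt_le_trans Hq1. Qed.
Let s0 : 0 < (2 * q)^-1. Proof. by rewrite invr_gt0 mulr_gt0. Qed.
Let L20 : 0 <= 2 * L. Proof. exact: mulr_ge0. Qed.

Lemma stability_I (Cq : R) : 0 <= Cq -> cond_I dist q Cq mu ->
  (WX dist q%:E pi pi' <=
     (N%:R `^ (q^-1 - einv p))%:E * Delta dist p mu mu'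
     + Cq%:E * ((2 * L)%:E * Delta dist p mu mu') `^ (2 * q)^-1)%E.
Proof.
move=> C0 HI; have [cpi _] := opt.
have [Doo|Dfin] := eqVneq (Delta dist p mu mu') +oo%E.
  rewrite (Delta_pinfty Doo) addye ?leey// -ltNye (@lt_le_trans _ _ 0%E)//.
  by rewrite mule_ge0 ?lee_fin// poweR_ge0.
have D0 := Delta_ge0 dist Hdist p mu mu'.
have Df : Delta dist p mu mu' \is a fin_num by rewrite ge0_fin_numE// ltey.
have d0 := fine_ge0 D0; set dl := fine (Delta dist p mu mu') in d0.
have DE : Delta dist p mu mu' = dl%:E by rewrite /dl fineK.
rewrite DE -EFinM -(EFinM (2 * L)) poweR_EFin -EFinM -EFinD powRM// mulrA.
(* The null term 0 * dl^1 fits the two-power shape of [le_right_limit]. *)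
suff : (WX dist q%:E pi pi' <= (N%:R `^ (q^-1 - einv p) * dl +
    Cq * (2 * L) `^ (2 * q)^-1 * dl `^ (2 * q)^-1 + 0 * dl `^ 1)%:E)%E.
  by rewrite mul0r addr0.
apply: le_right_limit => // M dlM.
have M0 : 0 <= M by rewrite (le_trans d0)// ltW.
have DM : (Delta dist p mu mu' < M%:E)%E by rewrite DE lte_fin.
rewrite mul0r addr0 -mulrA -powRM// EFinD.
apply: stability_le => // th cth KLth.
apply: (le_trans (HI pi th cpi cth)); rewrite EFinM lee_wpmul2l ?lee_fin//.
by rewrite -poweR_EFin; apply: le_poweR => //; [exact: ltW|exact: KL_ge0].
Qed.

Lemma stability_I' (Cq : R) : 0 <= Cq -> cond_I' dist q Cq mu ->
  (WX dist q%:E pi pi' <=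
     (N%:R `^ (q^-1 - einv p))%:E * Delta dist p mu mu'
     + Cq%:E * (((2 * L)%:E * Delta dist p mu mu') `^ q^-1
                + (L%:E * Delta dist p mu mu') `^ (2 * q)^-1))%E.
Proof.
move=> C0 HI; have [cpi _] := opt.
have [Doo|Dfin] := eqVneq (Delta dist p mu mu') +oo%E.
  rewrite (Delta_pinfty Doo) addye ?leey// -ltNye (@lt_le_trans _ _ 0%E)//.
  by rewrite mule_ge0 ?lee_fin// adde_ge0// poweR_ge0.
have D0 := Delta_ge0 dist Hdist p mu mu'.
have Df : Delta dist p mu mu' \is a fin_num by rewrite ge0_fin_numE// ltey.
have d0 := fine_ge0 D0; set dl := fine (Delta dist p mu mu') in d0.
have DE : Delta dist p mu mu' = dl%:E by rewrite /dl fineK.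
rewrite DE -[leRHS]/((N%:R `^ (q^-1 - einv p) * dl +
  Cq * ((2 * L * dl) `^ q^-1 + (L * dl) `^ (2 * q)^-1))%:E).
rewrite [(2 * L * dl) `^ _]powRM// [(L * dl) `^ _]powRM// mulrDr !mulrA addrA.
have qV0 : 0 < q^-1 by rewrite invr_gt0.
apply: le_right_limit => // M dlM.
have M0 : 0 <= M by rewrite (le_trans d0)// ltW.
have DM : (Delta dist p mu mu' < M%:E)%E by rewrite DE lte_fin.
have -> : N%:R `^ (q^-1 - einv p) * M + Cq * (2 * L) `^ q^-1 * M `^ q^-1 +
    Cq * L `^ (2 * q)^-1 * M `^ (2 * q)^-1 =
    N%:R `^ (q^-1 - einv p) * M + Cq * ((2 * L * M) `^ q^-1 + (L * M) `^ (2 * q)^-1).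
  rewrite [(2 * L * M) `^ _]powRM// [(L * M) `^ _]powRM//; ring.
rewrite EFinD.
apply: stability_le => // th cth KLth.
apply: (le_trans (HI pi th cpi cth)); rewrite EFinM lee_wpmul2l ?lee_fin// EFinD -!poweR_EFin.
apply: leeD; apply: le_poweR; rewrite ?KL_ge0 ?(ltW s0) ?(ltW qV0)//.
- by rewrite mule_ge0 ?KL_ge0// lee_fin invr_ge0.
(* Half of the entropy bound 2 L M: this is why the second power in the estimate has L Delta instead
   of 2 L Delta. *)
- apply: (@le_trans _ _ ((2 * L * M)%:E * (2^-1)%:E)%E).
    by rewrite lee_wpmul2r// lee_fin invr_ge0.
  by rewrite -EFinM lee_fin; lra.
Qed.

End stability.

(** * From the estimates to Hölder continuity *)

Section hoelder.
Context {R : realType}.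

(** Boundedness absorbs the linear term of the estimates into the smaller power s: split dl as
    dl^(1-s) dl^s. *)
Lemma le_mulr_powR (dl B s : R) : 0 <= dl -> dl <= B -> s <= 1 ->
  dl <= B `^ (1 - s) * dl `^ s.
Proof.
move=> d0 dB s1; have B0 : 0 <= B by exact: le_trans dB.
rewrite -{1}[dl]powRr1// -{1}(subrK s 1) powRD ?subrK ?oner_eq0//.
rewrite ler_wpM2r ?powR_ge0//; apply: ge0_ler_powR; rewrite ?nnegrE//.
by rewrite subr_ge0.
Qed.

Lemma le_powRD (dl B s : R) : 0 <= dl -> dl <= B -> 0 < s ->
  dl `^ (s + s) <= B `^ s * dl `^ s.
Proof.
move=> d0 dB s0; have B0 : 0 <= B by exact: le_trans dB.
rewrite powRD; last by rewrite gt_eqF// addr_gt0.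
rewrite ler_wpM2r ?powR_ge0//.
by apply: ge0_ler_powR; rewrite ?nnegrE// ltW.
Qed.

End hoelder.

Theorem mainTheorem7 (R : realType) (N : nat) (dX : 'I_N -> measure_display)
    (X : forall i, measurableType (dX i)) (dist : forall i, X i -> X i -> R)
    (Hpolish : forall i, polish_borel (dist i))
    (p : \bar R) (q : R) (c : ProdX X -> R)
    (Hp : (1%:E <= p)%E) (Hq1 : 1 <= q) (Hqp : (q%:E <= p)%E)
    (Hc0 : forall x, 0 <= c x) (Hcc : cost_continuous dist c)
    (Hcg : growth_order dist p c) :
  (* first estimate, under (I_q) *)
  (forall (mu mu' : forall i, probability (X i) R)
          (P P' : probability (ProdX X) R) (pi pi' : probability (ProdX X) R)
          (L Cq : R),
     (forall i, Pp (dist i) p (mu i)) -> (forall i, Pp (dist i) p (mu' i)) ->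
     is_product_measure mu P -> is_product_measure mu' P' ->
     0 <= L -> cond_A dist p c L mu mu' ->
     0 <= Cq -> cond_I dist q Cq mu ->
     is_Sent_optimizer mu P c pi -> is_Sent_optimizer mu' P' c pi' ->
     (WX dist q%:E pi pi' <=
        (N%:R `^ (q^-1 - einv p))%:E * Delta dist p mu mu'
        + Cq%:E * ((2 * L)%:E * Delta dist p mu mu') `^ (2 * q)^-1)%E)
  /\
  (* second estimate, under (I'_q) *)
  (forall (mu mu' : forall i, probability (X i) R)
          (P P' : probability (ProdX X) R) (pi pi' : probability (ProdX X) R)
          (L Cq' : R),
     (forall i, Pp (dist i) p (mu i)) -> (forall i, Pp (dist i) p (mu' i)) ->
     is_product_measure mu P -> is_product_measure mu' P' ->
     0 <= L -> cond_A dist p c L mu mu' ->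
     0 <= Cq' -> cond_I' dist q Cq' mu ->
     is_Sent_optimizer mu P c pi -> is_Sent_optimizer mu' P' c pi' ->
     (WX dist q%:E pi pi' <=
        (N%:R `^ (q^-1 - einv p))%:E * Delta dist p mu mu'
        + Cq'%:E * (((2 * L)%:E * Delta dist p mu mu') `^ q^-1
                    + (L%:E * Delta dist p mu mu') `^ (2 * q)^-1))%E)
  /\
  (* in particular: 1/(2p)-Hoelder continuity of the optimizer on W_p-bounded
     sets of marginal tuples satisfying (A_L) and (I_p) (resp. (I'_p)) *)
  (forall p' : R, p = p'%:E ->
   forall (L Cp B : R), 0 <= L -> 0 <= Cp ->
   exists K : R, 0 <= K /\
   forall (mu mu' : forall i, probability (X i) R)
          (P P' : probability (ProdX X) R) (pi pi' : probability (ProdX X) R),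
     (forall i, Pp (dist i) p (mu i)) -> (forall i, Pp (dist i) p (mu' i)) ->
     is_product_measure mu P -> is_product_measure mu' P' ->
     cond_A dist p c L mu mu' ->
     (cond_I dist p' Cp mu \/ cond_I' dist p' Cp mu) ->
     (Delta dist p mu mu' <= B%:E)%E ->
     is_Sent_optimizer mu P c pi -> is_Sent_optimizer mu' P' c pi' ->
     (WX dist p pi pi' <= K%:E * (Delta dist p mu mu') `^ (2 * p')^-1)%E).
Proof.
split=> [|]; last split.
- move=> mu mu' P P' pi pi' L Cq Hmu Hmu' HP HP' HL HA HC HI op op'.
  exact: (stability_I dist Hpolish p q c Hp Hq1 Hqp Hc0 Hcc Hcg mu mu' P P' pi pi' L).
- move=> mu mu' P P' pi pi' L Cq Hmu Hmu' HP HP' HL HA HC HI op op'.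
  exact: (stability_I' dist Hpolish p q c Hp Hq1 Hqp Hc0 Hcc Hcg mu mu' P P' pi pi' L).
move=> p' pE L Cp B HL HC; pose s := (2 * p')^-1.
have p1 : 1 <= p' by rewrite -lee_fin -pE.
have p0 : 0 < p' by rewrite (lt_le_trans ltr01).
have s0 : 0 < s by rewrite invr_gt0 mulr_gt0.
have s1 : s <= 1 by rewrite invf_le1 ?mulr_gt0//; lra.
have ssE : s + s = p'^-1 by rewrite /s; field; rewrite gt_eqF.
have L20 : 0 <= 2 * L by rewrite mulr_ge0.
(* The sum of the linear term and of both entropy terms, so one constant serves under either
   condition; the absolute value is there because B may be negative. *)
pose K := `|B| `^ (1 - s) + Cp * (2 * L) `^ s
  + Cp * ((2 * L) `^ p'^-1 * `|B| `^ s + L `^ s).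
exists K; split.
  by rewrite !addr_ge0 ?mulr_ge0 ?addr_ge0 ?mulr_ge0 ?powR_ge0.
move=> mu mu' P P' pi pi' Hmu Hmu' HP HP' HA HI HB op op'.
have D0 := Delta_ge0 dist Hpolish p mu mu'.
have Df : Delta dist p mu mu' \is a fin_num.
  by rewrite ge0_fin_numE// (le_lt_trans HB) ?ltry.
pose dl := fine (Delta dist p mu mu').
have DE : Delta dist p mu mu' = dl%:E by rewrite /dl fineK.
have d0 : 0 <= dl by exact: fine_ge0.
have dB : dl <= `|B| by rewrite (le_trans _ (ler_norm B))// -lee_fin -DE.
have ds0 : 0 <= dl `^ s by exact: powR_ge0.
(* At q = p the exponent of N is 0, and x^0 = 1 also for N = 0. *)
have powN1 : N%:R `^ (p'^-1 - einv p) = 1 :> R by rewrite pE /= subrr powRr0.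
have p'p : (p'%:E <= p)%E by rewrite pE.
have e1 := le_mulr_powR dl `|B| s d0 dB s1.
have e2 := le_powRD dl `|B| s d0 dB s0.
have e3 : (2 * L * dl) `^ s = (2 * L) `^ s * dl `^ s by rewrite powRM.
have e4 : (L * dl) `^ s = L `^ s * dl `^ s by rewrite powRM.
have e5 : (2 * L * dl) `^ p'^-1 <= (2 * L) `^ p'^-1 * `|B| `^ s * dl `^ s.
  by rewrite [leLHS]powRM// -mulrA ler_wpM2l ?powR_ge0// -ssE.
rewrite -[leLHS]/(WX dist p pi pi') [in leLHS]pE DE poweR_EFin -EFinM -/s.
case: HI => HI.
- have := stability_I dist Hpolish p p' c Hp p1 p'p Hc0 Hcc Hcg mu mu' P P' pi pi' L
    Hmu Hmu' HP HP' HL HA op op' Cp HC HI.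
  rewrite powN1 mul1e DE -[leRHS]/((dl + Cp * (2 * L * dl) `^ s)%:E) e3.
  move=> /le_trans; apply; rewrite lee_fin /K !mulrDl -addrA lerD// mulrA lerDl.
  by rewrite mulr_ge0// mulr_ge0// addr_ge0 ?mulr_ge0 ?powR_ge0.
- have := stability_I' dist Hpolish p p' c Hp p1 p'p Hc0 Hcc Hcg mu mu' P P' pi pi' L
    Hmu Hmu' HP HP' HL HA op op' Cp HC HI.
  rewrite powN1 mul1e DE -[leRHS]/((dl + Cp * ((2 * L * dl) `^ p'^-1 + (L * dl) `^ s))%:E) e4.
  move=> /le_trans; apply; rewrite lee_fin.
  have h1 : Cp * ((2 * L * dl) `^ p'^-1 + L `^ s * dl `^ s) <=
      Cp * ((2 * L) `^ p'^-1 * `|B| `^ s + L `^ s) * dl `^ s.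
    by rewrite -[leRHS]mulrA; apply: ler_wpM2l => //; rewrite [leRHS]mulrDl; exact: lerD.
  have h2 : 0 <= Cp * (2 * L) `^ s * dl `^ s by rewrite !mulr_ge0 ?powR_ge0.
  by rewrite /K [leRHS]mulrDl [X in _ <= X + _]mulrDl; lra.
Qed.
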